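(* Let $a>0$, $e\in[0,1)$, $\varepsilon>0$, $\eta>0$, and consider the spin-orbit problem with tidal torque $$\frac{d^2x(t)}{dt^2}+\varepsilon\Bigl(\frac{a}{r(t)}\Bigr)^3\sin\bigl(2x(t)-2f(t)\bigr)=-\eta\Bigl(\frac{a}{r(t)}\Bigr)^6\Bigl(\frac{dx(t)}{dt}-\frac{df(t)}{dt}\Bigr),$$ where $r(t)$ and $f(t)$ are the orbital radius and the true anomaly of the Keplerian ellipse with semimajor axis $a$ and eccentricity $e$. The $2\pi$-time map (from time $t=0$ to time $t=2\pi$) of this equation, written as a first-order system in $(x,y)$ with $y=\frac{dx}{dt}$, is conformally symplectic, with conformal factor $$\lambda=\exp\Bigl(-\eta\,\pi\,\frac{3e^4+24e^2+8}{4(1-e^2)^{9/2}}\Bigr).$$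
   Context: The functions $r(t)>0$ and $f(t)$ are defined through the eccentric anomaly $u=u(t)$, which is determined by Kepler's equation $t=u-e\sin u$, via $$r=a(1-e\cos u),\qquad r\,\exp(\mathrm{i} f)=a\bigl(\cos u-e+\mathrm{i}\sqrt{1-e^2}\,\sin u\bigr),$$ with $f$ the continuous determination satisfying $f=0$ at $t=0$ (so $f=\pi$ at $t=\pi$). The eccentricity $e$ is a parameter (it is not the base of the natural logarithm). The variable $x$ is an angle modulo $2\pi$ and $y\in\mathbb{R}$; the phase space is endowed with the standard area form $\Omega=dy\wedge dx$. A diffeomorphism $g$ of the phase space is called conformally symplectic with conformal factor $\lambda$ if $g^*\Omega=\lambda\,\Omega$, where $g^*$ denotes the pull-back by $g$. *)

(* Defs.v *)
From Stdlib Require Export Reals ZArith.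
From Coquelicot Require Export Coquelicot.

Open Scope R_scope.

Definition expi (theta : R) : C := (cos theta, sin theta).

(* Kepler's equation determines [u], hence [r]; the last three fields determine
   [f], which is the continuous branch of the argument vanishing at [t = 0]. *)
Record keplerian (a e : R) (u r f : R -> R) : Prop := {
  kepler_equation : forall t, t = u t - e * sin (u t);
  orbital_radius : forall t, r t = a * (1 - e * cos (u t));
  true_anomaly : forall t,
    (RtoC (r t) * expi (f t))%C
    = (RtoC a * (cos (u t) - e, sqrt (1 - e ^ 2) * sin (u t))%R)%C;
  true_anomaly_continuous : forall t, continuous f t;
  true_anomaly_0 : f 0 = 0
}.

Definition spin_orbit_solution (a eps eta : R) (r f : R -> R)
    (x y : R -> R) : Prop :=
  forall t,
    is_derive x t (y t) /\
    ex_derive y t /\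
    Derive y t + eps * (a / r t) ^ 3 * sin (2 * x t - 2 * f t)
    = - eta * (a / r t) ^ 6 * (y t - Derive f t).

(* Points of the phase space (R / 2 pi Z) x R are represented by pairs
   [(x, y) : R * R], identified by [same_state]. *)
Definition same_state (p q : R * R) : Prop :=
  (exists k : Z, fst q = fst p + IZR k * (2 * PI)) /\ snd q = snd p.

(* [g] is the map sending the state at time [t0] to the state at time [t1]:
   every initial state has a solution, and every solution ends at its image
   under [g] (so that [g] is unique). *)
Definition time_map (solution : (R -> R) -> (R -> R) -> Prop) (t0 t1 : R)
    (g : R * R -> R * R) : Prop :=
  forall p : R * R,
    (exists x y, solution x y /\ (x t0, y t0) = p) /\
    (forall x y, solution x y -> (x t0, y t0) = p -> g p = (x t1, y t1)).

Definition smooth2 (h : R * R -> R) : Prop :=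
  forall (n : nat) (x y : R), ex_diff_n (fun x y => h (x, y)) n x y.

(* A smooth map of the phase space into itself, given by a lift to R * R;
   every smooth self-map of the cylinder has such a lift. *)
Definition smooth_phase_map (g : R * R -> R * R) : Prop :=
  (forall p q, same_state p q -> same_state (g p) (g q)) /\
  smooth2 (fun p => fst (g p)) /\ smooth2 (fun p => snd (g p)).

Definition phase_diffeomorphism (g : R * R -> R * R) : Prop :=
  smooth_phase_map g /\
  exists h, smooth_phase_map h /\
    (forall p, same_state (h (g p)) p) /\ (forall p, same_state (g (h p)) p).

Definition partial1 (h : R * R -> R) (p : R * R) : R :=
  Derive (fun z => h (z, snd p)) (fst p).

Definition partial2 (h : R * R -> R) (p : R * R) : R :=
  Derive (fun z => h (fst p, z)) (snd p).

Definition differential (g : R * R -> R * R) (p v : R * R) : R * R :=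
  let d h := partial1 h p * fst v + partial2 h p * snd v in
  (d (fun q => fst (g q)), d (fun q => snd (g q))).

(* A 2-form takes a base point and two tangent vectors. *)
Definition form2 : Type := R * R -> R * R -> R * R -> R.

(* Omega = dy /\ dx *)
Definition Omega : form2 := fun _ v w => snd v * fst w - snd w * fst v.

Definition pullback (g : R * R -> R * R) (omega : form2) : form2 :=
  fun p v w => omega (g p) (differential g p v) (differential g p w).

Definition conformally_symplectic (g : R * R -> R * R) (lambda : R) : Prop :=
  phase_diffeomorphism g /\
  forall p v w, pullback g Omega p v w = lambda * Omega p v w.

(* Main.v *)
Require Import Defs.
From Stdlib Require Import Lra Lia.

(** Put [g = eta (a / r)^6], [b = eps (a / r)^3] and [psi = 2 f]. The equation is
    that of a damped, forced pendulum with time-dependent coefficients,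
    [x' = y], [y' = - g y + g f' - b sin (2 x - psi)].

    Three facts about such an equation give a conformally symplectic map. First,
    its right-hand side is globally Lipschitz in the state, so solutions exist on
    the whole line ([picard_lindelof]), and they are determined by their initial
    value by Gronwall's inequality ([gronwall]). Secondly, the flow is smooth: its
    first derivatives in the initial value exist and solve the variational
    equation ([pendulum_derivative]), which is linear with a coefficient that is as
    smooth as the flow itself; since solutions of a linear equation are as smooth
    in a parameter as the coefficients ([linear_family_Cn]), each order of
    smoothness yields the next ([pendulum_Cn]). Reversing time gives an equation of
    the same form, whose flow is the inverse map. Thirdly, the divergence of the
    vector field is [- g], so that by Liouville's formula
    ([variation_determinant]) the map multiplies areas by [exp (- int g)]. The map
    commutes with the translations of [x] by [2 PI] by uniqueness, so that it is
    defined on the cylinder.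

    Smoothness is expressed by the class [param_Cn] of functions of time and of a
    planar parameter: all the estimates are uniform for times in [[0, T]], which
    is what Gronwall's inequality consumes and produces.

    It remains to integrate [g] over a revolution. Kepler's equation gives
    [du/dt = 1 / (1 - e cos u)], whence [df/dt = sqrt (1 - e^2) (a / r)^2], and
    [a / r = (1 + e cos f) / (1 - e^2)]. Hence
    [g dt = eta (1 - e^2)^(- 9 / 2) (1 + e cos f)^4 df], a trigonometric polynomial
    in [f], and [f] increases by exactly [2 PI] ([true_anomaly_2PI]). *)

(** * Global solutions of planar systems *)

Lemma derive_nonneg_le (f f' : R -> R) (a b : R) :
  a <= b ->
  (forall t, a <= t <= b -> is_derive f t (f' t)) ->
  (forall t, a <= t <= b -> 0 <= f' t) ->
  f a <= f b.
Proof.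
intros Hab Hd Hp.
destruct (MVT_gen f a b f') as [c [Hc Heq]].
- intros t Ht. apply Hd.
  rewrite Rmin_left, Rmax_right in Ht by lra. lra.
- intros t Ht. rewrite Rmin_left, Rmax_right in Ht by lra.
  apply derivable_continuous_pt. exists (f' t).
  apply is_derive_Reals. now apply Hd.
- rewrite Rmin_left, Rmax_right in Hc by lra.
  specialize (Hp c Hc).
  assert (0 <= f' c * (b - a)) by (apply Rmult_le_pos; lra). lra.
Qed.

(** Comparison of primitives that vanish at [0], on both sides of [0]. *)
Lemma derive_bound (f f' g g' : R -> R) :
  (forall t, is_derive f t (f' t)) -> (forall t, is_derive g t (g' t)) ->
  (forall t, Rabs (f' t) <= g' t) -> f 0 = 0 -> g 0 = 0 ->
  forall t, Rabs (f t) <= Rabs (g t).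
Proof.
intros Hf Hg Hle f0 g0 t.
assert (Hm : forall t, is_derive (fun s => g s - f s) t (g' t - f' t))
  by (intro; apply (is_derive_minus g f); auto).
assert (Hp : forall t, is_derive (fun s => g s + f s) t (g' t + f' t))
  by (intro; apply (is_derive_plus g f); auto).
assert (Hm0 : forall t, 0 <= g' t - f' t)
  by (intro s; specialize (Hle s); apply Rabs_le_between in Hle; lra).
assert (Hp0 : forall t, 0 <= g' t + f' t)
  by (intro s; specialize (Hle s); apply Rabs_le_between in Hle; lra).
destruct (Rle_dec 0 t) as [Ht|Ht].
- assert (H1 := derive_nonneg_le _ _ 0 t Ht (fun s _ => Hm s) (fun s _ => Hm0 s)).
  assert (H2 := derive_nonneg_le _ _ 0 t Ht (fun s _ => Hp s) (fun s _ => Hp0 s)).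
  simpl in H1, H2. apply Rabs_le_between. unfold Rabs; destruct Rcase_abs; lra.
- assert (Ht' : t <= 0) by lra.
  assert (H1 := derive_nonneg_le _ _ t 0 Ht' (fun s _ => Hm s) (fun s _ => Hm0 s)).
  assert (H2 := derive_nonneg_le _ _ t 0 Ht' (fun s _ => Hp s) (fun s _ => Hp0 s)).
  simpl in H1, H2. apply Rabs_le_between. unfold Rabs; destruct Rcase_abs; lra.
Qed.

Lemma is_derive_primitive (f : R -> R) (x0 : R) :
  (forall t, continuous f t) ->
  forall t, is_derive (fun s => x0 + RInt f 0 s) t (f t).
Proof.
intros Hf t.
evar_last.
apply (is_derive_plus (fun _ => x0) (fun s => RInt f 0 s)).
apply is_derive_const.
apply is_derive_RInt with 0.
- apply filter_forall. intros b. apply (RInt_correct f).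
  apply (ex_RInt_continuous f). auto.
- auto.
- apply Rplus_0_l.
Qed.

Lemma is_derive_continuous (f : R -> R) (t l : R) :
  is_derive f t l -> continuous f t.
Proof.
intros H. apply (ex_derive_continuous f). now exists l.
Qed.

Lemma continuous_Rplus (f g : R -> R) (t : R) :
  continuous f t -> continuous g t -> continuous (fun s => f s + g s) t.
Proof. intros; now apply (continuous_plus f g). Qed.

Lemma continuous_Rmult (f g : R -> R) (t : R) :
  continuous f t -> continuous g t -> continuous (fun s => f s * g s) t.
Proof. intros; now apply (continuous_mult f g). Qed.

Lemma continuous_Ropp (f : R -> R) (t : R) :
  continuous f t -> continuous (fun s => - f s) t.
Proof. intros; now apply (continuous_opp f). Qed.

Lemma continuous_Rabs_fct (f : R -> R) (t : R) :
  continuous f t -> continuous (fun s => Rabs (f s)) t.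
Proof. intros; apply (continuous_comp f Rabs); auto. apply continuous_Rabs. Qed.

Lemma continuous_sin_fct (f : R -> R) (t : R) :
  continuous f t -> continuous (fun s => sin (f s)) t.
Proof. intros; apply (continuous_comp f sin); auto. apply continuous_sin. Qed.

Lemma continuous_locally_lt (f : R -> R) (t eps : R) :
  continuous f t -> 0 < eps ->
  locally t (fun s => Rabs (f s - f t) < eps).
Proof.
intros Hf He. apply (Hf (fun y => Rabs (y - f t) < eps)).
exists (mkposreal eps He). intros y Hy. exact Hy.
Qed.

Lemma pow_half_small (M eps : R) :
  0 < eps -> exists n, M * (1 / 2) ^ n < eps.
Proof.
intros He.
destruct (pow_lt_1_zero (1 / 2)) with (y := eps / (Rabs M + 1)) as [N HN].
- rewrite Rabs_pos_eq; lra.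
- apply Rdiv_lt_0_compat; auto. assert (H := Rabs_pos M); lra.
- exists N. specialize (HN N (le_n N)).
  assert (HM := Rabs_pos M). assert (Hp : 0 < (1 / 2) ^ N) by (apply pow_lt; lra).
  rewrite Rabs_pos_eq in HN by lra.
  apply Rlt_div_r in HN; [|lra].
  assert (M <= Rabs M) by apply Rle_abs.
  nra.
Qed.

Lemma eq_0_of_abs_le (x : R) : (forall eps, 0 < eps -> Rabs x <= eps) -> x = 0.
Proof.
intros Hx. destruct (Req_dec x 0) as [|H0]; auto.
apply Rabs_pos_lt in H0. specialize (Hx (Rabs x / 2)). lra.
Qed.

(** A limit that is uniform with respect to a continuous weight is continuous. *)
Lemma continuous_weighted_limit (u : nat -> R -> R) (w x : R -> R) :
  (forall n t, continuous (u n) t) -> (forall t, continuous w t) ->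
  (forall n t, Rabs (x t - u n t) <= (1 / 2) ^ n * w t) ->
  forall t, continuous x t.
Proof.
intros Hu Hw Hx t. apply filterlim_locally. intros eps.
destruct (pow_half_small (w t + 1) (eps / 4)) as [n Hn].
{ assert (H := cond_pos eps); lra. }
assert (He4 : 0 < eps / 4) by (assert (H := cond_pos eps); lra).
generalize (filter_and _ _ (continuous_locally_lt _ _ _ (Hu n t) He4)
              (continuous_locally_lt _ _ _ (Hw t) Rlt_0_1)).
apply filter_imp. intros s [H1 H2].
change (Rabs (x s - x t) < eps).
assert (Hs := Hx n s). assert (Ht := Hx n t).
assert (Hp : 0 < (1 / 2) ^ n) by (apply pow_lt; lra).
apply Rabs_lt_between in H2.
assert (Hws : (1 / 2) ^ n * w s <= (w t + 1) * (1 / 2) ^ n)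
  by (rewrite Rmult_comm; apply Rmult_le_compat_r; lra).
assert (Hwt : (1 / 2) ^ n * w t <= (w t + 1) * (1 / 2) ^ n)
  by (rewrite Rmult_comm; apply Rmult_le_compat_r; lra).
apply Rabs_le_between in Hs. apply Rabs_le_between in Ht.
apply Rabs_lt_between in H1. apply Rabs_lt_between. lra.
Qed.

(** The solutions on the whole line of [x' = F (t, x, y)], [y' = H (t, x, y)]. *)
Definition planar_solution (F H : R -> R -> R -> R) (x y : R -> R) : Prop :=
  forall t, is_derive x t (F t (x t) (y t)) /\ is_derive y t (H t (x t) (y t)).

(** Continuity of a vector field in the form that integral equations need:
    along continuous curves. *)
Definition preserves_continuity (F : R -> R -> R -> R) : Prop :=
  forall x y : R -> R, (forall t, continuous x t) -> (forall t, continuous y t) ->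
  forall t, continuous (fun s => F s (x s) (y s)) t.

(** Lipschitz continuity in the state, with a constant that may depend on time. *)
Definition lipschitz_system (F H : R -> R -> R -> R) (m : R -> R) : Prop :=
  forall t x y x' y',
  Rabs (F t x y - F t x' y') <= m t * (Rabs (x - x') + Rabs (y - y')) /\
  Rabs (H t x y - H t x' y') <= m t * (Rabs (x - x') + Rabs (y - y')).

(** Picard's iterates for the initial value [(x0, y0)] at time [0]. *)
Fixpoint picard (F H : R -> R -> R -> R) (x0 y0 : R) (n : nat) :
    (R -> R) * (R -> R) :=
  match n with
  | O => (fun _ => x0, fun _ => y0)
  | S n =>
      let x := fst (picard F H x0 y0 n) in
      let y := snd (picard F H x0 y0 n) in
      (fun t => x0 + RInt (fun s => F s (x s) (y s)) 0 t,
       fun t => y0 + RInt (fun s => H s (x s) (y s)) 0 t)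
  end.

(** The two components of the solution with initial value [p] at time [0], defined
    as the limits of Picard's iterates. *)
Definition sol1 (F H : R -> R -> R -> R) (p : R * R) (t : R) : R :=
  real (Lim_seq (fun n => fst (picard F H (fst p) (snd p) n) t)).

Definition sol2 (F H : R -> R -> R -> R) (p : R * R) (t : R) : R :=
  real (Lim_seq (fun n => snd (picard F H (fst p) (snd p) n) t)).

Lemma limit_of_geometric_increments (u : nat -> R) (w : R) :
  (forall n, Rabs (u (S n) - u n) <= (1 / 2) ^ (S n) * w) ->
  forall n, Rabs (real (Lim_seq u) - u n) <= (1 / 2) ^ n * w.
Proof.
intros Hu.
assert (Hw : 0 <= w).
{ specialize (Hu O). assert (H := Rabs_pos (u 1%nat - u O)). simpl in Hu. lra. }
assert (Hk : forall n k, Rabs (u (n + k)%nat - u n) <= ((1 / 2) ^ n - (1/2) ^ (n + k)) * w).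
{ intros n k. induction k as [|k IH].
  - rewrite Nat.add_0_r, !Rminus_diag, Rabs_R0. lra.
  - replace (n + S k)%nat with (S (n + k)) by lia.
    replace (u (S (n + k)) - u n)
      with ((u (S (n + k)) - u (n + k)%nat) + (u (n + k)%nat - u n)) by ring.
    eapply Rle_trans. apply Rabs_triang.
    specialize (Hu (n + k)%nat). simpl in Hu |- *. lra. }
assert (Hpos : forall n, 0 < (1 / 2) ^ n) by (intro; apply pow_lt; lra).
assert (Hk' : forall n k, (n <= k)%nat -> Rabs (u k - u n) <= (1 / 2) ^ n * w).
{ intros n k Hnk. replace k with (n + (k - n))%nat by lia.
  eapply Rle_trans. apply Hk.
  apply Rmult_le_compat_r; auto. specialize (Hpos (n + (k - n))%nat). lra. }
assert (Hlim : is_lim_seq u (Finite (real (Lim_seq u)))).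
{ apply Lim_seq_correct'. apply ex_lim_seq_cauchy_corr. intros eps.
  destruct (pow_half_small w (eps / 2)) as [N HN].
  { assert (H := cond_pos eps); lra. }
  exists N. intros n k Hn Hkk.
  assert (H1 := Hk' N n Hn). assert (H2 := Hk' N k Hkk).
  rewrite Rmult_comm in HN.
  apply Rabs_le_between in H1. apply Rabs_le_between in H2.
  apply Rabs_lt_between. lra. }
intros n.
assert (Hd : is_lim_seq (fun k => Rabs (u k - u n)) (Rabs (real (Lim_seq u) - u n))).
{ apply (is_lim_seq_abs _ (Finite _)).
  apply is_lim_seq_minus'; auto. apply is_lim_seq_const. }
apply (is_lim_seq_le_loc _ (fun _ => (1 / 2) ^ n * w) (Finite _) (Finite _)
         (ex_intro _ n (Hk' n)) Hd).
apply is_lim_seq_const.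
Qed.

(** Global Picard-Lindelof theorem. Let [W' = m'], where [m'] dominates [2 m]. The
    iterated map halves distances measured with the weight
    [w = exp (2 W) + exp (- 2 W)]: the primitive [sinh (2 W)] of [m' w] is bounded
    by [w / 2], for positive and for negative times alike. *)
Theorem picard_lindelof (F H : R -> R -> R -> R) (m : R -> R) (p : R * R) :
  preserves_continuity F -> preserves_continuity H ->
  (forall t, continuous m t) -> lipschitz_system F H m ->
  planar_solution F H (sol1 F H p) (sol2 F H p) /\
  sol1 F H p 0 = fst p /\ sol2 F H p 0 = snd p.
Proof.
destruct p as [x0 y0]. intros HF HH Hm0 Hlip. unfold sol1, sol2. simpl fst; simpl snd.
(* [2 m] bounds the two components together; the other terms of the enlarged
   constant control the first increment *)
set (m' := fun t => 2 * m t + (Rabs (F t x0 y0) + Rabs (H t x0 y0))).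
assert (Hm : forall t, continuous m' t).
{ intro t. unfold m'. apply continuous_Rplus.
  { apply continuous_Rmult; auto. apply continuous_const. }
  apply continuous_Rplus; apply continuous_Rabs_fct.
  - apply (HF (fun _ => x0) (fun _ => y0)); intro; apply continuous_const.
  - apply (HH (fun _ => x0) (fun _ => y0)); intro; apply continuous_const. }
assert (Hmpos : forall t, 0 <= m t).
{ intros t. destruct (Hlip t 1 0 0 0) as [H1 _].
  rewrite !Rminus_0_r, Rabs_R1, Rabs_R0 in H1.
  assert (H2 := Rabs_pos (F t 1 0 - F t 0 0)). lra. }
assert (Hmm' : forall t, 2 * m t <= m' t).
{ intros t. unfold m'. assert (A := Rabs_pos (F t x0 y0)).
  assert (B := Rabs_pos (H t x0 y0)). lra. }
set (W := fun t => 0 + RInt m' 0 t).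
assert (HW : forall t, is_derive W t (m' t)) by now apply is_derive_primitive.
assert (HexW : forall t, ex_derive W t) by (intro t; eexists; apply HW).
set (w := fun t => exp (2 * W t) + exp (- (2 * W t))).
assert (Hw1 : forall t, 1 <= w t).
{ intros t. unfold w. assert (A := exp_ineq1_le (2 * W t)).
  assert (B := exp_ineq1_le (- (2 * W t))). lra. }
assert (Hwc : forall t, continuous w t).
{ intros t. eapply is_derive_continuous. unfold w.
  auto_derive; [|reflexivity]. repeat split; apply HexW. }
assert (Hcontr : forall c f f' g g', 0 <= c ->
  (forall t, is_derive f t (f' t)) -> (forall t, is_derive g t (g' t)) ->
  f 0 = g 0 -> (forall t, Rabs (f' t - g' t) <= m' t * (c * w t)) ->
  forall t, Rabs (f t - g t) <= c / 2 * w t).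
{ intros c f f' g g' Hc Hf Hg H0 Hle t.
  eapply Rle_trans.
  - apply (derive_bound (fun s => f s - g s) (fun s => f' s - g' s)
      (fun s => c / 2 * (exp (2 * W s) - exp (- (2 * W s))))
      (fun s => m' s * (c * w s))); auto.
    + intros s. apply (is_derive_minus f g); auto.
    + intros s. unfold w. auto_derive.
      * repeat split; apply HexW.
      * replace (Derive (fun x => W x) s) with (m' s)
          by (symmetry; apply is_derive_unique, HW).
        field.
    + lra.
    + unfold W. rewrite RInt_point. change (@zero R_CompleteNormedModule) with 0.
      rewrite Rplus_0_l, Rmult_0_r, Ropp_0. ring.
  - rewrite Rabs_mult, (Rabs_pos_eq (c / 2)) by lra.
    apply Rmult_le_compat_l; [lra|]. unfold w.
    assert (A := exp_pos (2 * W t)). assert (B := exp_pos (- (2 * W t))).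
    apply Rabs_le_between. lra. }
set (u := fun n => fst (picard F H x0 y0 n)).
set (v := fun n => snd (picard F H x0 y0 n)).
change (planar_solution F H (fun t => Lim_seq (fun n => u n t))
          (fun t => Lim_seq (fun n => v n t)) /\
        real (Lim_seq (fun n => u n 0)) = x0 /\
        real (Lim_seq (fun n => v n 0)) = y0).
assert (Hstep : forall n, (forall t, continuous (u n) t) ->
  (forall t, continuous (v n) t) ->
  forall t, is_derive (u (S n)) t (F t (u n t) (v n t)) /\
            is_derive (v (S n)) t (H t (u n t) (v n t))).
{ intros n Hu Hv t. split.
  - apply (is_derive_primitive (fun s => F s (u n s) (v n s)) x0).
    now apply HF.
  - apply (is_derive_primitive (fun s => H s (u n s) (v n s)) y0).
    now apply HH. }
assert (Hcont : forall n, (forall t, continuous (u n) t) /\ (forall t, continuous (v n) t)).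
{ induction n as [|n [IHu IHv]].
  - split; intro; apply continuous_const.
  - split; intro t.
    + exact (is_derive_continuous _ _ _ (proj1 (Hstep n IHu IHv t))).
    + exact (is_derive_continuous _ _ _ (proj2 (Hstep n IHu IHv t))). }
assert (Hder : forall n t, is_derive (u (S n)) t (F t (u n t) (v n t)) /\
                           is_derive (v (S n)) t (H t (u n t) (v n t))).
{ intros n t. apply Hstep; apply Hcont. }
assert (Hinit : forall n, u n 0 = x0 /\ v n 0 = y0).
{ intros [|n]; [now split|]. unfold u, v; simpl. rewrite !RInt_point.
  split; apply Rplus_0_r. }
assert (Hpow : forall n, 0 < (1 / 2) ^ n) by (intro; apply pow_lt; lra).
assert (Hsum : forall dx dy c s D, 0 <= c -> Rabs D <= m s * (Rabs dx + Rabs dy) ->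
  Rabs dx <= c * w s -> Rabs dy <= c * w s -> Rabs D <= m' s * (c * w s)).
{ intros dx dy c s D Hc HD Hdx Hdy. eapply Rle_trans; [apply HD|].
  apply Rle_trans with (2 * m s * (c * w s)).
  - specialize (Hmpos s). nra.
  - apply Rmult_le_compat_r; [|apply Hmm'].
    apply Rmult_le_pos; auto. specialize (Hw1 s); lra. }
assert (Hinc : forall n t,
  Rabs (u (S n) t - u n t) <= (1 / 2) ^ (S n) * w t /\
  Rabs (v (S n) t - v n t) <= (1 / 2) ^ (S n) * w t).
{ induction n as [|n IH].
  - assert (Hm'w : forall t, 0 <= m' t * (w t - 1)).
    { intros t. apply Rmult_le_pos; [|specialize (Hw1 t); lra].
      eapply Rle_trans; [|apply Hmm']. specialize (Hmpos t). lra. }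
    assert (Hd0 : forall c t, is_derive (fun _ : R => c : R) t 0)
      by (intros; apply (is_derive_const c t)).
    intros t. split.
    + replace ((1 / 2) ^ 1) with (1 / 2) by ring.
      apply Hcontr with (fun s => F s (u O s) (v O s)) (fun _ => 0); try lra.
      * intros s. apply Hder.
      * exact (Hd0 x0).
      * now rewrite !(proj1 (Hinit _)).
      * intros s. change (u O s) with x0. change (v O s) with y0.
        rewrite Rminus_0_r. specialize (Hm'w s).
        apply Rle_trans with (m' s); [|lra]. unfold m'.
        assert (A := Rabs_pos (H s x0 y0)). specialize (Hmpos s). lra.
    + replace ((1 / 2) ^ 1) with (1 / 2) by ring.
      apply Hcontr with (fun s => H s (u O s) (v O s)) (fun _ => 0); try lra.
      * intros s. apply Hder.
      * exact (Hd0 y0).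
      * now rewrite !(proj2 (Hinit _)).
      * intros s. change (u O s) with x0. change (v O s) with y0.
        rewrite Rminus_0_r. specialize (Hm'w s).
        apply Rle_trans with (m' s); [|lra]. unfold m'.
        assert (A := Rabs_pos (F s x0 y0)). specialize (Hmpos s). lra.
  - intros t.
    assert (Hc := Rlt_le _ _ (Hpow (S n))).
    replace ((1 / 2) ^ S (S n)) with ((1 / 2) ^ S n / 2) by (simpl; field).
    split.
    + apply Hcontr with (fun s => F s (u (S n) s) (v (S n) s))
        (fun s => F s (u n s) (v n s)); try apply Hder; auto.
      * now rewrite !(proj1 (Hinit _)).
      * intros s. apply (Hsum (u (S n) s - u n s) (v (S n) s - v n s)); auto.
        -- apply Hlip.
        -- apply IH.
        -- apply IH.
    + apply Hcontr with (fun s => H s (u (S n) s) (v (S n) s))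
        (fun s => H s (u n s) (v n s)); try apply Hder; auto.
      * now rewrite !(proj2 (Hinit _)).
      * intros s. apply (Hsum (u (S n) s - u n s) (v (S n) s - v n s)); auto.
        -- apply Hlip.
        -- apply IH.
        -- apply IH. }
set (x := fun t => real (Lim_seq (fun n => u n t))).
set (y := fun t => real (Lim_seq (fun n => v n t))).
assert (Hx : forall n t, Rabs (x t - u n t) <= (1 / 2) ^ n * w t).
{ intros n t. apply (limit_of_geometric_increments (fun n => u n t)).
  intros k. apply Hinc. }
assert (Hy : forall n t, Rabs (y t - v n t) <= (1 / 2) ^ n * w t).
{ intros n t. apply (limit_of_geometric_increments (fun n => v n t)).
  intros k. apply Hinc. }
assert (Hxc : forall t, continuous x t)
  by (apply (continuous_weighted_limit u w); auto; intros; apply Hcont).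
assert (Hyc : forall t, continuous y t)
  by (apply (continuous_weighted_limit v w); auto; intros; apply Hcont).
assert (Hlimit : forall f g M, (forall n, Rabs (f - g) <= M * (1 / 2) ^ n) -> f = g).
{ intros f g M Hfg. apply Rminus_diag_uniq. apply eq_0_of_abs_le. intros eps Heps.
  destruct (pow_half_small M eps Heps) as [n Hn]. specialize (Hfg n). lra. }
assert (Hxe : forall t, x t = x0 + RInt (fun s => F s (x s) (y s)) 0 t).
{ intros t. apply Hlimit with (2 * w t). intros n.
  assert (Hn := Hpow n). specialize (Hw1 t).
  assert (A := Hx (S n) t).
  assert (B : Rabs (u (S n) t - (x0 + RInt (fun s => F s (x s) (y s)) 0 t))
              <= (1 / 2) ^ n / 2 * w t).
  { apply (Hcontr ((1 / 2) ^ n) (u (S n)) (fun s => F s (u n s) (v n s))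
      (fun t => x0 + RInt (fun s => F s (x s) (y s)) 0 t)
      (fun s => F s (x s) (y s))); try lra.
    - apply Hder.
    - apply is_derive_primitive. now apply HF.
    - rewrite RInt_point, (proj1 (Hinit _)). symmetry. apply Rplus_0_r.
    - intros s. apply (Hsum (u n s - x s) (v n s - y s)); try lra.
      + apply Hlip.
      + rewrite Rabs_minus_sym. apply Hx.
      + rewrite Rabs_minus_sym. apply Hy. }
  simpl in A. apply Rabs_le_between in A. apply Rabs_le_between in B.
  apply Rabs_le_between. nra. }
assert (Hye : forall t, y t = y0 + RInt (fun s => H s (x s) (y s)) 0 t).
{ intros t. apply Hlimit with (2 * w t). intros n.
  assert (Hn := Hpow n). specialize (Hw1 t).
  assert (A := Hy (S n) t).
  assert (B : Rabs (v (S n) t - (y0 + RInt (fun s => H s (x s) (y s)) 0 t))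
              <= (1 / 2) ^ n / 2 * w t).
  { apply (Hcontr ((1 / 2) ^ n) (v (S n)) (fun s => H s (u n s) (v n s))
      (fun t => y0 + RInt (fun s => H s (x s) (y s)) 0 t)
      (fun s => H s (x s) (y s))); try lra.
    - apply Hder.
    - apply is_derive_primitive. now apply HH.
    - rewrite RInt_point, (proj2 (Hinit _)). symmetry. apply Rplus_0_r.
    - intros s. apply (Hsum (u n s - x s) (v n s - y s)); try lra.
      + apply Hlip.
      + rewrite Rabs_minus_sym. apply Hx.
      + rewrite Rabs_minus_sym. apply Hy. }
  simpl in A. apply Rabs_le_between in A. apply Rabs_le_between in B.
  apply Rabs_le_between. nra. }
split; [intros t; split|split].
- apply (is_derive_ext (fun t => x0 + RInt (fun s => F s (x s) (y s)) 0 t)).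
  { intros s. symmetry. apply Hxe. }
  apply (is_derive_primitive (fun s => F s (x s) (y s))). now apply HF.
- apply (is_derive_ext (fun t => y0 + RInt (fun s => H s (x s) (y s)) 0 t)).
  { intros s. symmetry. apply Hye. }
  apply (is_derive_primitive (fun s => H s (x s) (y s))). now apply HH.
- change (x 0 = x0). rewrite Hxe, RInt_point. apply Rplus_0_r.
- change (y 0 = y0). rewrite Hye, RInt_point. apply Rplus_0_r.
Qed.

(** * Gronwall's inequality *)

(** Amplification factor over [[0, T]] for a system with Lipschitz constant [L]. *)
Definition gronwall_constant (L T : R) : R := 2 * exp ((4 * L + 1) * T).

(** A single number [eps] bounds both the initial values and the inhomogeneous
    term; the conclusion is linear in it. *)
Lemma gronwall (T L eps kappa : R) (z v w : R -> R) :
  0 <= L -> Rabs kappa <= L -> 0 <= eps ->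
  (forall t, is_derive z t (kappa * v t)) ->
  (forall t, is_derive v t (w t)) ->
  (forall t, 0 <= t <= T -> Rabs (w t) <= L * (Rabs (z t) + Rabs (v t)) + eps) ->
  Rabs (z 0) <= eps -> Rabs (v 0) <= eps ->
  forall t, 0 <= t <= T ->
    Rabs (z t) <= gronwall_constant L T * eps /\
    Rabs (v t) <= gronwall_constant L T * eps.
Proof.
intros HL Hk Heps Hz Hv Hw Hz0 Hv0 t Ht.
set (M := 4 * L + 1).
(* the energy [z^2 + v^2 + eps^2] grows at most at the rate [M] *)
set (E := fun s => - ((z s ^ 2 + v s ^ 2 + eps ^ 2) * exp (- (M * s)))).
set (E' := fun s => (M * (z s ^ 2 + v s ^ 2 + eps ^ 2)
                     - 2 * (z s * (kappa * v s) + v s * w s)) * exp (- (M * s))).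
assert (HE : E 0 <= E t).
{ apply (derive_nonneg_le E E'); [lra| |].
  - intros s _. unfold E, E'. auto_derive.
    + repeat split; eexists; [apply Hz|apply Hv].
    + replace (Derive (fun x => z x) s) with (kappa * v s)
        by (symmetry; apply is_derive_unique, Hz).
      replace (Derive (fun x => v x) s) with (w s)
        by (symmetry; apply is_derive_unique, Hv).
      ring.
  - intros s Hs. unfold E'. apply Rmult_le_pos; [|apply Rlt_le, exp_pos].
    assert (Hs' : 0 <= s <= T) by lra. specialize (Hw s Hs').
    assert (A : z s * (kappa * v s) <= L * (Rabs (z s) * Rabs (v s))).
    { eapply Rle_trans; [apply Rle_abs|]. rewrite !Rabs_mult.
      assert (P := Rmult_le_pos _ _ (Rabs_pos (z s)) (Rabs_pos (v s))). nra. }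
    assert (B : v s * w s <= Rabs (v s) * (L * (Rabs (z s) + Rabs (v s)) + eps)).
    { eapply Rle_trans; [apply Rle_abs|]. rewrite Rabs_mult.
      apply Rmult_le_compat_l; auto. apply Rabs_pos. }
    rewrite <- (pow2_abs (z s)), <- (pow2_abs (v s)). unfold M.
    set (a := Rabs (z s)) in *. set (b := Rabs (v s)) in *.
    assert (0 <= L * (a - b) ^ 2) by (apply Rmult_le_pos; auto; apply pow2_ge_0).
    assert (0 <= L * a ^ 2) by (apply Rmult_le_pos; auto; apply pow2_ge_0).
    assert (0 <= L * eps ^ 2) by (apply Rmult_le_pos; auto; apply pow2_ge_0).
    assert (0 <= (b - eps) ^ 2) by apply pow2_ge_0.
    assert (0 <= a ^ 2) by apply pow2_ge_0. nra. }
unfold E in HE. rewrite Rmult_0_r, Ropp_0, exp_0 in HE.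
assert (Hz2 : z 0 ^ 2 <= eps ^ 2).
{ rewrite <- pow2_abs. apply pow_incr. split; auto. apply Rabs_pos. }
assert (Hv2 : v 0 ^ 2 <= eps ^ 2).
{ rewrite <- pow2_abs. apply pow_incr. split; auto. apply Rabs_pos. }
assert (Hexp : exp (- (M * t)) * exp (M * t) = 1).
{ rewrite <- exp_plus, Rplus_opp_l. apply exp_0. }
set (C := gronwall_constant L T).
assert (HC : C = 2 * exp (M * T)) by reflexivity.
assert (Hmono : exp (M * t) <= exp (M * T)).
{ destruct (Rle_lt_or_eq_dec t T) as [Hlt|Heq]; [lra| |subst; lra].
  apply Rlt_le, exp_increasing, Rmult_lt_compat_l; unfold M; lra. }
assert (H1 : 1 <= exp (M * T)).
{ assert (A := exp_ineq1_le (M * T)).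
  assert (0 <= M * T) by (apply Rmult_le_pos; unfold M; lra). lra. }
assert (Hp := exp_pos (M * t)).
assert (Htot : z t ^ 2 + v t ^ 2 + eps ^ 2 <= 3 * eps ^ 2 * exp (M * t)).
{ replace (z t ^ 2 + v t ^ 2 + eps ^ 2)
    with ((z t ^ 2 + v t ^ 2 + eps ^ 2) * exp (- (M * t)) * exp (M * t))
    by (rewrite Rmult_assoc, Hexp; ring).
  apply Rmult_le_compat_r; lra. }
assert (Hfin : z t ^ 2 + v t ^ 2 <= (C * eps) ^ 2).
{ assert (0 <= eps ^ 2) by apply pow2_ge_0.
  assert (0 <= z t ^ 2) by apply pow2_ge_0.
  rewrite HC. replace ((2 * exp (M * T) * eps) ^ 2)
    with (eps ^ 2 * (4 * (exp (M * T) * exp (M * T)))) by ring.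
  assert (exp (M * t) <= exp (M * T) * exp (M * T)) by nra.
  assert (eps ^ 2 * (3 * exp (M * t)) <= eps ^ 2 * (4 * (exp (M * T) * exp (M * T))))
    by (apply Rmult_le_compat_l; lra). lra. }
assert (0 <= C * eps) by (apply Rmult_le_pos; lra).
assert (0 <= z t ^ 2) by apply pow2_ge_0.
assert (0 <= v t ^ 2) by apply pow2_ge_0.
rewrite <- (Rabs_pos_eq (C * eps)) by lra.
split; apply Rsqr_le_abs_0; rewrite !Rsqr_pow2; lra.
Qed.

(** * Functions of time smooth in a planar parameter, uniformly in time *)

(** Translation of a point of the plane along the first ([true]) or the second
    ([false]) coordinate axis. *)
Definition shift (i : bool) (k : R) (p : R * R) : R * R :=
  if i then (fst p + k, snd p) else (fst p, snd p + k).

(** Continuity in time on the whole line, and in the parameter uniformly for times in [[0, T]]. *)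
Definition param_continuous (T : R) (f : R -> R * R -> R) : Prop :=
  (forall p t, continuous (fun s => f s p) t) /\
  (forall p eps, 0 < eps ->
     locally p (fun p' => forall t, 0 <= t <= T -> Rabs (f t p' - f t p) <= eps)).

(** [f'] is the partial derivative of [f] in the direction [i] of the parameter
    space, uniformly for times in [[0, T]]. *)
Definition param_derivative (T : R) (i : bool) (f f' : R -> R * R -> R) : Prop :=
  forall p eps, 0 < eps ->
    locally 0 (fun k => forall t, 0 <= t <= T ->
      Rabs (f t (shift i k p) - f t p - k * f' t p) <= eps * Rabs k).

(** The class C^n in the parameter, uniformly in time. *)
Fixpoint param_Cn (T : R) (n : nat) (f : R -> R * R -> R) : Prop :=
  param_continuous T f /\
  match n with
  | O => True
  | S n => forall i, exists f', param_derivative T i f f' /\ param_Cn T n f'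
  end.

Lemma param_Cn_continuous T n f : param_Cn T n f -> param_continuous T f.
Proof. destruct n; intros H; apply H. Qed.

Lemma param_Cn_S T n f : param_Cn T (S n) f -> param_Cn T n f.
Proof.
revert f. induction n as [|n IH]; intros f [Hc Hd].
- now split.
- split; auto. intros i. destruct (Hd i) as [f' [H1 H2]].
  exists f'. split; auto.
Qed.

Lemma locally_shift (i : bool) (p : R * R) (P : R * R -> Prop) :
  locally p P -> locally 0 (fun k => P (shift i k p)).
Proof.
intros [d Hd]. exists d. intros k Hk. apply Hd.
change (Rabs (k - 0) < d) in Hk. rewrite Rminus_0_r in Hk.
assert (H0 : Rabs 0 < d) by (rewrite Rabs_R0; apply cond_pos).
destruct p as [x y]. destruct i; split.
- change (Rabs (x + k - x) < d). now rewrite Rplus_minus_l.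
- change (Rabs (y - y) < d). now rewrite Rminus_diag.
- change (Rabs (x - x) < d). now rewrite Rminus_diag.
- change (Rabs (y + k - y) < d). now rewrite Rplus_minus_l.
Qed.

Lemma bounded_on_segment (T : R) (f : R -> R) :
  0 <= T -> (forall t, continuous f t) ->
  exists M, 0 <= M /\ forall t, 0 <= t <= T -> Rabs (f t) <= M.
Proof.
intros HT Hf.
destruct (continuity_ab_maj (fun t => Rabs (f t)) 0 T HT) as [t0 [H _]].
- intros c _. apply continuity_pt_filterlim.
  apply (continuous_Rabs_fct f). apply Hf.
- exists (Rabs (f t0)). split; auto. apply Rabs_pos.
Qed.

(** Choice of a small number [d] in a linear estimate with constant [A]. *)
Lemma small_factor (A eps : R) :
  0 <= A -> 0 < eps -> exists d, 0 < d /\ d <= 1 /\ d * A <= eps.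
Proof.
intros HA He. exists (Rmin 1 (eps / (A + 1))).
assert (H : 0 < eps / (A + 1)) by (apply Rdiv_lt_0_compat; lra).
repeat split.
- apply Rmin_glb_lt; lra.
- apply Rmin_l.
- apply Rle_trans with (eps / (A + 1) * A).
  + apply Rmult_le_compat_r; auto. apply Rmin_r.
  + assert (E : eps / (A + 1) * (A + 1) = eps) by (field; lra). lra.
Qed.

Lemma locally_0_lt (d : R) : 0 < d -> locally 0 (fun k => Rabs k < d).
Proof.
intros Hd. exists (mkposreal d Hd). intros k Hk.
change (Rabs (k - 0) < d) in Hk. now rewrite Rminus_0_r in Hk.
Qed.

Lemma param_Cn_cst T n (f : R -> R) :
  (forall t, continuous f t) -> param_Cn T n (fun t _ => f t).
Proof.
assert (Hc : forall g, (forall t, continuous g t) -> param_continuous T (fun t _ => g t)).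
{ intros g Hg. split; auto. intros p eps He. apply filter_forall. intros p' t _.
  rewrite Rminus_diag, Rabs_R0. lra. }
revert f. induction n as [|n IH]; intros f Hf; simpl.
- split; auto.
- split; auto. intros i. exists (fun _ _ => 0). split.
  + intros p eps He. apply filter_forall. intros k t _.
    replace (f t - f t - k * 0) with 0 by ring. rewrite Rabs_R0.
    apply Rmult_le_pos; [lra|apply Rabs_pos].
  + apply (IH (fun _ => 0)). intros t. apply continuous_const.
Qed.

Lemma param_continuous_plus T f g :
  param_continuous T f -> param_continuous T g ->
  param_continuous T (fun t p => f t p + g t p).
Proof.
intros [Hf Hf'] [Hg Hg']. split.
- intros p t. apply (continuous_Rplus (fun s => f s p) (fun s => g s p)); auto.
- intros p eps He. assert (He2 : 0 < eps / 2) by lra.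
  generalize (filter_and _ _ (Hf' p _ He2) (Hg' p _ He2)).
  apply filter_imp. intros p' [A B] t Ht.
  replace (f t p' + g t p' - (f t p + g t p))
    with ((f t p' - f t p) + (g t p' - g t p)) by ring.
  eapply Rle_trans; [apply Rabs_triang|]. specialize (A t Ht). specialize (B t Ht). lra.
Qed.

Lemma param_Cn_plus T n f g :
  param_Cn T n f -> param_Cn T n g -> param_Cn T n (fun t p => f t p + g t p).
Proof.
revert f g. induction n as [|n IH]; intros f g [Hf Hf'] [Hg Hg'].
- split; auto. now apply param_continuous_plus.
- split; [now apply param_continuous_plus|]. intros i.
  destruct (Hf' i) as [f1 [Hf1 Hf2]]. destruct (Hg' i) as [g1 [Hg1 Hg2]].
  exists (fun t p => f1 t p + g1 t p). split; auto.
  intros p eps He. assert (He2 : 0 < eps / 2) by lra.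
  generalize (filter_and _ _ (Hf1 p _ He2) (Hg1 p _ He2)).
  apply filter_imp. intros k [A B] t Ht.
  replace (f t (shift i k p) + g t (shift i k p) - (f t p + g t p) - k * (f1 t p + g1 t p))
    with ((f t (shift i k p) - f t p - k * f1 t p)
          + (g t (shift i k p) - g t p - k * g1 t p)) by ring.
  eapply Rle_trans; [apply Rabs_triang|]. specialize (A t Ht). specialize (B t Ht). lra.
Qed.

Lemma param_continuous_mult T f g : 0 <= T ->
  param_continuous T f -> param_continuous T g ->
  param_continuous T (fun t p => f t p * g t p).
Proof.
intros HT [Hf Hf'] [Hg Hg']. split.
- intros p t. apply (continuous_Rmult (fun s => f s p) (fun s => g s p)); auto.
- intros p eps He.
  destruct (bounded_on_segment T (fun s => f s p) HT (Hf p)) as [F [HF0 HF]].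
  destruct (bounded_on_segment T (fun s => g s p) HT (Hg p)) as [G [HG0 HG]].
  destruct (small_factor (F + G + 1) eps) as [d [Hd [Hd1 Hde]]]; [lra|auto|].
  generalize (filter_and _ _ (Hf' p _ Hd) (Hg' p _ Hd)).
  apply filter_imp. intros p' [A B] t Ht.
  specialize (A t Ht). specialize (B t Ht). specialize (HF t Ht). specialize (HG t Ht).
  replace (f t p' * g t p' - f t p * g t p)
    with ((f t p' - f t p) * (g t p' - g t p) + (f t p' - f t p) * g t p
          + f t p * (g t p' - g t p)) by ring.
  eapply Rle_trans; [apply Rabs_triang|].
  eapply Rle_trans; [apply Rplus_le_compat_r, Rabs_triang|].
  rewrite !Rabs_mult.
  assert (P1 := Rabs_pos (f t p' - f t p)). assert (P2 := Rabs_pos (g t p' - g t p)).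
  assert (P3 := Rabs_pos (f t p)). assert (P4 := Rabs_pos (g t p)).
  assert (Rabs (f t p' - f t p) * Rabs (g t p' - g t p) <= d * 1)
    by (apply Rmult_le_compat; lra).
  assert (Rabs (f t p' - f t p) * Rabs (g t p) <= d * G)
    by (apply Rmult_le_compat; lra).
  assert (Rabs (f t p) * Rabs (g t p' - g t p) <= F * d)
    by (apply Rmult_le_compat; lra).
  lra.
Qed.

Lemma param_Cn_mult T n f g : 0 <= T ->
  param_Cn T n f -> param_Cn T n g -> param_Cn T n (fun t p => f t p * g t p).
Proof.
intros HT. revert f g. induction n as [|n IH]; intros f g Hf Hg.
- split; auto. apply param_continuous_mult; auto; [apply Hf|apply Hg].
- assert (HfS := param_Cn_S _ _ _ Hf). assert (HgS := param_Cn_S _ _ _ Hg).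
  destruct Hf as [Hf Hf']. destruct Hg as [Hg Hg'].
  split; [now apply param_continuous_mult|]. intros i.
  destruct (Hf' i) as [f1 [Hf1 Hf2]]. destruct (Hg' i) as [g1 [Hg1 Hg2]].
  exists (fun t p => f1 t p * g t p + f t p * g1 t p). split.
  2: { apply param_Cn_plus; auto. }
  intros p eps He.
  destruct (bounded_on_segment T (fun s => f s p) HT (proj1 Hf p)) as [F [HF0 HF]].
  destruct (bounded_on_segment T (fun s => g s p) HT (proj1 Hg p)) as [G [HG0 HG]].
  destruct (bounded_on_segment T (fun s => f1 s p) HT
    (proj1 (param_Cn_continuous _ _ _ Hf2) p)) as [F1 [HF10 HF1]].
  destruct (small_factor (F + G + 1 + F1) eps) as [d [Hd [Hd1 Hde]]]; [lra|auto|].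
  generalize (filter_and _ _ (filter_and _ _ (Hf1 p _ Hd) (Hg1 p _ Hd))
    (locally_shift i p _ (proj2 Hg p _ Hd))).
  apply filter_imp. intros k [[A B] C] t Ht.
  specialize (A t Ht). specialize (B t Ht). specialize (C t Ht).
  specialize (HF t Ht). specialize (HG t Ht). specialize (HF1 t Ht).
  set (p' := shift i k p) in *.
  replace (f t p' * g t p' - f t p * g t p - k * (f1 t p * g t p + f t p * g1 t p))
    with ((f t p' - f t p - k * f1 t p) * (g t p + (g t p' - g t p))
          + k * (f1 t p * (g t p' - g t p))
          + f t p * (g t p' - g t p - k * g1 t p)) by ring.
  eapply Rle_trans; [apply Rabs_triang|].
  eapply Rle_trans; [apply Rplus_le_compat_r, Rabs_triang|].
  rewrite !Rabs_mult.
  assert (Pg := Rabs_triang (g t p) (g t p' - g t p)).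
  assert (Pk := Rabs_pos k).
  assert (Rabs (f t p' - f t p - k * f1 t p) * Rabs (g t p + (g t p' - g t p))
          <= d * Rabs k * (G + 1)) by (apply Rmult_le_compat; try apply Rabs_pos; lra).
  assert (Rabs (f1 t p) * Rabs (g t p' - g t p) <= F1 * d)
    by (apply Rmult_le_compat; try apply Rabs_pos; lra).
  assert (Rabs k * (Rabs (f1 t p) * Rabs (g t p' - g t p)) <= Rabs k * (F1 * d))
    by (apply Rmult_le_compat_l; lra).
  assert (Rabs (f t p) * Rabs (g t p' - g t p - k * g1 t p) <= F * (d * Rabs k))
    by (apply Rmult_le_compat; try apply Rabs_pos; lra).
  assert (d * (F + G + 1 + F1) * Rabs k <= eps * Rabs k)
    by (apply Rmult_le_compat_r; lra).
  lra.
Qed.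

Lemma sin_lipschitz (a b : R) : Rabs (sin b - sin a) <= Rabs (b - a).
Proof.
destruct (MVT_gen sin a b cos) as [c [_ Hc]].
- intros; apply is_derive_sin.
- intros; apply continuity_sin.
- rewrite Hc, Rabs_mult. assert (A := Rabs_pos (b - a)).
  assert (B : Rabs (cos c) <= 1) by (apply Rabs_le_between, COS_bound). nra.
Qed.

Lemma cos_lipschitz (a b : R) : Rabs (cos b - cos a) <= Rabs (b - a).
Proof.
rewrite !cos_sin. eapply Rle_trans; [apply sin_lipschitz|].
right. f_equal. ring.
Qed.

Lemma sin_first_order (a b : R) :
  Rabs (sin b - sin a - cos a * (b - a)) <= Rabs (b - a) ^ 2.
Proof.
destruct (MVT_gen sin a b cos) as [c [Hab Hc]].
- intros; apply is_derive_sin.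
- intros; apply continuity_sin.
- rewrite Hc, <- Rmult_minus_distr_r, Rabs_mult. simpl. rewrite Rmult_1_r.
  apply Rmult_le_compat_r; [apply Rabs_pos|].
  eapply Rle_trans; [apply cos_lipschitz|].
  unfold Rmin, Rmax in Hab. destruct Rle_dec; unfold Rabs; do 2 destruct Rcase_abs; lra.
Qed.

Lemma param_continuous_sin T f :
  param_continuous T f -> param_continuous T (fun t p => sin (f t p)).
Proof.
intros [Hf Hf']. split.
- intros p t. apply (continuous_sin_fct (fun s => f s p)). auto.
- intros p eps He. generalize (Hf' p eps He). apply filter_imp.
  intros p' A t Ht. eapply Rle_trans; [apply sin_lipschitz|auto].
Qed.

(** The cosine that appears in the derivative is written as a translated sine, so
    that the induction on the order concerns one function only. *)
Lemma param_Cn_sin T n f : 0 <= T ->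
  param_Cn T n f -> param_Cn T n (fun t p => sin (f t p)).
Proof.
intros HT. revert f. induction n as [|n IH]; intros f Hf.
- split; auto. apply param_continuous_sin. apply Hf.
- assert (HfS := param_Cn_S _ _ _ Hf). destruct Hf as [Hf Hf'].
  split; [now apply param_continuous_sin|]. intros i.
  destruct (Hf' i) as [f1 [Hf1 Hf2]].
  exists (fun t p => sin (PI / 2 + f t p) * f1 t p). split.
  2: { apply param_Cn_mult; auto. apply IH. apply param_Cn_plus; auto.
       apply (param_Cn_cst T n (fun _ => PI / 2)). intros t. apply continuous_const. }
  intros p eps He.
  destruct (bounded_on_segment T (fun s => f1 s p) HT
    (proj1 (param_Cn_continuous _ _ _ Hf2) p)) as [F1 [HF10 HF1]].
  assert (He2 : 0 < eps / 2) by lra.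
  destruct (small_factor ((1 + F1) ^ 2) (eps / 2)) as [d [Hd [Hd1 Hde]]];
    [apply pow2_ge_0|auto|].
  generalize (filter_and _ _ (filter_and _ _ (Hf1 p _ He2) (Hf1 p _ Rlt_0_1))
    (locally_0_lt d Hd)).
  apply filter_imp. intros k [[A B] Hk] t Ht.
  specialize (A t Ht). specialize (B t Ht). specialize (HF1 t Ht).
  rewrite <- cos_sin.
  set (p' := shift i k p) in *.
  replace (sin (f t p') - sin (f t p) - k * (cos (f t p) * f1 t p))
    with ((sin (f t p') - sin (f t p) - cos (f t p) * (f t p' - f t p))
          + cos (f t p) * (f t p' - f t p - k * f1 t p)) by ring.
  eapply Rle_trans; [apply Rabs_triang|].
  assert (C := sin_first_order (f t p) (f t p')).
  rewrite (Rabs_mult (cos _)).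
  assert (Hcos : Rabs (cos (f t p)) <= 1) by (apply Rabs_le_between, COS_bound).
  assert (D : Rabs (f t p' - f t p) <= (1 + F1) * Rabs k).
  { replace (f t p' - f t p) with ((f t p' - f t p - k * f1 t p) + k * f1 t p) by ring.
    eapply Rle_trans; [apply Rabs_triang|]. rewrite (Rabs_mult k).
    assert (Rabs k * Rabs (f1 t p) <= Rabs k * F1)
      by (apply Rmult_le_compat_l; auto; apply Rabs_pos). lra. }
  assert (D2 : Rabs (f t p' - f t p) ^ 2 <= ((1 + F1) * Rabs k) ^ 2)
    by (apply pow_incr; split; auto; apply Rabs_pos).
  assert (E : ((1 + F1) * Rabs k) ^ 2 <= eps / 2 * Rabs k).
  { replace (((1 + F1) * Rabs k) ^ 2) with ((Rabs k * (1 + F1) ^ 2) * Rabs k) by ring.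
    apply Rmult_le_compat_r; [apply Rabs_pos|].
    eapply Rle_trans; [|apply Hde]. apply Rmult_le_compat_r; [apply pow2_ge_0|lra]. }
  assert (G : Rabs (cos (f t p)) * Rabs (f t p' - f t p - k * f1 t p)
          <= 1 * (eps / 2 * Rabs k)) by (apply Rmult_le_compat; auto; apply Rabs_pos).
  lra.
Qed.

Lemma param_Cn_scal T n c f : 0 <= T ->
  param_Cn T n f -> param_Cn T n (fun t p => c * f t p).
Proof.
intros HT Hf. apply (param_Cn_mult T n (fun _ _ => c)); auto.
apply (param_Cn_cst T n (fun _ => c)). intros t. apply continuous_const.
Qed.

Lemma param_derivative_is_derive T i f f' p t : 0 <= t <= T ->
  param_derivative T i f f' -> is_derive (fun k => f t (shift i k p)) 0 (f' t p).
Proof.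
intros Ht Hf. split; [apply is_linear_scal_l|].
intros x Hx.
rewrite <- (is_filter_lim_locally_unique (K := R_AbsRing) (V := R_NormedModule) 0 x Hx).
intros eps. generalize (Hf p eps (cond_pos eps)). apply filter_imp.
intros k Hk. specialize (Hk t Ht).
change (Rabs (f t (shift i k p) - f t (shift i 0 p) - (k - 0) * f' t p)
        <= eps * Rabs (k - 0)).
assert (H0 : shift i 0 p = p) by (destruct p, i; unfold shift; simpl; now rewrite Rplus_0_r).
now rewrite H0, Rminus_0_r.
Qed.

Lemma param_derivative_partial1 T f f' t x y : 0 <= t <= T ->
  param_derivative T true f f' -> is_derive (fun z => f t (z, y)) x (f' t (x, y)).
Proof.
intros Ht Hf.
apply (is_derive_ext (fun z => f t (shift true (z - x) (x, y)))).
{ intros z. unfold shift. simpl. f_equal. f_equal. ring. }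
evar_last.
- apply (is_derive_comp (fun k => f t (shift true k (x, y))) (fun z => z - x)).
  + rewrite Rminus_diag. apply (param_derivative_is_derive T true f f' (x, y) t Ht Hf).
  + auto_derive; [trivial|reflexivity].
- apply Rmult_1_l.
Qed.

Lemma param_derivative_partial2 T f f' t x y : 0 <= t <= T ->
  param_derivative T false f f' -> is_derive (fun z => f t (x, z)) y (f' t (x, y)).
Proof.
intros Ht Hf.
apply (is_derive_ext (fun z => f t (shift false (z - y) (x, y)))).
{ intros z. unfold shift. simpl. f_equal. f_equal. ring. }
evar_last.
- apply (is_derive_comp (fun k => f t (shift false k (x, y))) (fun z => z - y)).
  + rewrite Rminus_diag. apply (param_derivative_is_derive T false f f' (x, y) t Ht Hf).
  + auto_derive; [trivial|reflexivity].
- apply Rmult_1_l.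
Qed.

Lemma ex_diff_n_ext_fct f g n x y :
  (forall x y, f x y = g x y) -> ex_diff_n f n x y -> ex_diff_n g n x y.
Proof.
revert f g. induction n as [|n IH]; intros f g Hfg [Hc Hd].
- split; auto. apply (continuity_2d_pt_ext f); auto.
- split; [apply (continuity_2d_pt_ext f); auto|].
  destruct Hd as [D1 [D2 [D3 D4]]]. repeat split.
  + apply (ex_derive_ext (fun z => f z y)); auto.
  + apply (ex_derive_ext (fun z => f x z)); auto.
  + apply (IH (fun u v => Derive (fun z => f z v) u)); auto.
    intros u v. now apply Derive_ext.
  + apply (IH (fun u v => Derive (fun z => f u z) v)); auto.
    intros u v. now apply Derive_ext.
Qed.

(** A function of class C^n in the parameter is, at each fixed time, of class C^n. *)
Lemma param_Cn_ex_diff_n T n f t : 0 <= t <= T ->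
  param_Cn T n f -> forall x y, ex_diff_n (fun x y => f t (x, y)) n x y.
Proof.
intros Ht. revert f. induction n as [|n IH]; intros f [Hc Hd] x y.
all: assert (Hc2 : continuity_2d_pt (fun x y => f t (x, y)) x y).
1, 3: intros eps;
  assert (He2 : 0 < eps / 2) by (assert (A := cond_pos eps); lra);
  destruct (proj2 Hc (x, y) _ He2) as [d Hd'];
  exists d; intros x' y' Hx Hy;
  assert (A : Rabs (f t (x', y') - f t (x, y)) <= eps / 2)
    by (apply (Hd' (x', y')); [split; [exact Hx|exact Hy]|exact Ht]);
  lra.
- split; auto.
- destruct (Hd true) as [f1 [Hf1 Hf1']]. destruct (Hd false) as [f2 [Hf2 Hf2']].
  split; auto. repeat split.
  + exists (f1 t (x, y)). now apply (param_derivative_partial1 T).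
  + exists (f2 t (x, y)). now apply (param_derivative_partial2 T).
  + apply (ex_diff_n_ext_fct (fun x y => f1 t (x, y))); auto.
    intros u v. symmetry. apply is_derive_unique. now apply (param_derivative_partial1 T).
  + apply (ex_diff_n_ext_fct (fun x y => f2 t (x, y))); auto.
    intros u v. symmetry. apply is_derive_unique. now apply (param_derivative_partial2 T).
Qed.

(** * Linear equations depending smoothly on a parameter *)

(** The first component [z' = kappa v] of all the systems below; [kappa] is [1],
    or [- 1] after a reversal of time. *)
Definition velocity (kappa : R) (t z v : R) : R := kappa * v.

(** The second component [v' = - g v - q z + h] of a linear system. *)
Definition linear_force (g q h : R -> R) (t z v : R) : R :=
  - g t * v - q t * z + h t.

Lemma velocity_continuous kappa : preserves_continuity (velocity kappa).
Proof.
intros x y _ Hy t. unfold velocity.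
apply (continuous_Rmult (fun _ => kappa) y); auto. apply continuous_const.
Qed.

Lemma linear_solution_exists (kappa : R) (g q h : R -> R) (p : R * R) :
  (forall t, continuous g t) -> (forall t, continuous q t) ->
  (forall t, continuous h t) ->
  let x := sol1 (velocity kappa) (linear_force g q h) p in
  let y := sol2 (velocity kappa) (linear_force g q h) p in
  planar_solution (velocity kappa) (linear_force g q h) x y /\
  x 0 = fst p /\ y 0 = snd p.
Proof.
intros Hg Hq Hh.
apply (picard_lindelof _ _ (fun t => Rabs kappa + (Rabs (g t) + Rabs (q t)))).
- apply velocity_continuous.
- intros x y Hx Hy t. unfold linear_force.
  apply (continuous_Rplus (fun s => - g s * y s - q s * x s) h); auto.
  apply (continuous_minus (fun s => - g s * y s) (fun s => q s * x s)).
  + apply (continuous_Rmult (fun s => - g s) y); auto. now apply continuous_Ropp.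
  + now apply (continuous_Rmult q x).
- intros t. apply (continuous_Rplus (fun _ => Rabs kappa)); [apply continuous_const|].
  apply continuous_Rplus; now apply continuous_Rabs_fct.
- intros t x y x' y'. unfold velocity, linear_force.
  replace (kappa * y - kappa * y') with (kappa * (y - y')) by ring.
  replace (- g t * y - q t * x + h t - (- g t * y' - q t * x' + h t))
    with (- (g t * (y - y') + q t * (x - x'))) by ring.
  rewrite Rabs_Ropp.
  assert (A := Rabs_triang (g t * (y - y')) (q t * (x - x'))).
  rewrite !Rabs_mult in *.
  assert (P1 := Rabs_pos kappa). assert (P2 := Rabs_pos (g t)).
  assert (P3 := Rabs_pos (q t)). assert (P4 := Rabs_pos (x - x')).
  assert (P5 := Rabs_pos (y - y')).
  split; nra.
Qed.

Lemma is_derive_first_order_remainder (f1 f2 f3 : R -> R) (k t l1 l2 l3 l : R) :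
  is_derive f1 t l1 -> is_derive f2 t l2 -> is_derive f3 t l3 ->
  l1 - l2 - k * l3 = l ->
  is_derive (fun s => f1 s - f2 s - k * f3 s) t l.
Proof.
intros H1 H2 H3 <-.
apply (is_derive_minus (fun s => f1 s - f2 s) (fun s => k * f3 s)).
- now apply (is_derive_minus f1 f2).
- now apply (is_derive_scal f3).
Qed.

Section LinearDependence.

Variables (T kappa : R) (g : R -> R).
Hypotheses (HT : 0 <= T) (Hg : forall t, continuous g t).

(** [z] and [v] solve the equation with coefficients [q] and [h], for each value
    of the parameter. *)
Definition linear_family (q h z v : R -> R * R -> R) : Prop :=
  forall p, planar_solution (velocity kappa)
    (linear_force g (fun t => q t p) (fun t => h t p))
    (fun t => z t p) (fun t => v t p).

Lemma solution_continuous F H x y :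
  planar_solution F H x y ->
  (forall t, continuous x t) /\ (forall t, continuous y t).
Proof.
intros Hs. split; intros t; eapply is_derive_continuous; apply Hs.
Qed.

(** The difference of two members of the family, minus [k] times a solution of
    the linear equation with force [r], is controlled by the corresponding
    combination of the coefficients. Continuity is the case [k = 0]; for
    differentiability, [k] is the increment of the parameter. *)
Lemma linear_family_gronwall (q h z v : R -> R * R -> R) (w u r : R -> R)
    (p p' : R * R) (k L eps : R) :
  linear_family q h z v ->
  planar_solution (velocity kappa) (linear_force g (fun t => q t p) r) w u ->
  z 0 p' - z 0 p - k * w 0 = 0 -> v 0 p' - v 0 p - k * u 0 = 0 ->
  0 <= eps -> Rabs kappa <= L ->
  (forall t, 0 <= t <= T -> Rabs (g t) <= L) ->
  (forall t, 0 <= t <= T -> Rabs (q t p') <= L) ->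
  (forall t, 0 <= t <= T ->
    Rabs ((h t p' - h t p - k * r t) - (q t p' - q t p) * (z t p + k * w t)) <= eps) ->
  forall t, 0 <= t <= T ->
    Rabs (z t p' - z t p - k * w t) <= gronwall_constant L T * eps /\
    Rabs (v t p' - v t p - k * u t) <= gronwall_constant L T * eps.
Proof.
intros Hzv Hwu Hz0 Hv0 Heps Hk HgL HqL Hr t Ht.
apply (gronwall T L eps kappa
  (fun t => z t p' - z t p - k * w t) (fun t => v t p' - v t p - k * u t)
  (fun t => - g t * (v t p' - v t p - k * u t)
            - q t p' * (z t p' - z t p - k * w t)
            + ((h t p' - h t p - k * r t) - (q t p' - q t p) * (z t p + k * w t))));
  auto.
- eapply Rle_trans; [apply Rabs_pos|apply Hk].
- intros s. apply (is_derive_first_order_remainder _ _ w k s _ _ _ _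
    (proj1 (Hzv p' s)) (proj1 (Hzv p s)) (proj1 (Hwu s))).
  unfold velocity. ring.
- intros s. apply (is_derive_first_order_remainder _ _ u k s _ _ _ _
    (proj2 (Hzv p' s)) (proj2 (Hzv p s)) (proj2 (Hwu s))).
  unfold linear_force. ring.
- intros s Hs. eapply Rle_trans; [apply Rabs_triang|].
  apply Rplus_le_compat; auto.
  eapply Rle_trans; [apply Rabs_triang|]. rewrite !Rabs_Ropp, !Rabs_mult, Rabs_Ropp.
  rewrite Rmult_plus_distr_l, Rplus_comm.
  apply Rplus_le_compat; apply Rmult_le_compat_r; auto; apply Rabs_pos.
- rewrite Hz0, Rabs_R0. auto.
- rewrite Hv0, Rabs_R0. auto.
Qed.

Lemma gronwall_constant_pos (L : R) : 0 < gronwall_constant L T.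
Proof. unfold gronwall_constant. assert (A := exp_pos ((4 * L + 1) * T)). lra. Qed.

(** Bounds that hold near [p], uniformly on [[0, T]]. *)
Lemma uniform_bound (q : R -> R * R -> R) (p : R * R) :
  param_continuous T q ->
  exists L, Rabs kappa <= L /\ (forall t, 0 <= t <= T -> Rabs (g t) <= L) /\
    locally p (fun p' => forall t, 0 <= t <= T -> Rabs (q t p') <= L).
Proof.
intros [Hq Hq'].
destruct (bounded_on_segment T (fun s => q s p) HT (Hq p)) as [Q [HQ0 HQ]].
destruct (bounded_on_segment T g HT Hg) as [G [HG0 HG]].
assert (Hk := Rabs_pos kappa).
exists (Rabs kappa + G + Q + 1). repeat split.
- lra.
- intros t Ht. specialize (HG t Ht). lra.
- generalize (Hq' p 1 Rlt_0_1). apply filter_imp. intros p' A t Ht.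
  specialize (A t Ht). specialize (HQ t Ht).
  replace (q t p') with (q t p + (q t p' - q t p)) by ring.
  eapply Rle_trans; [apply Rabs_triang|]. lra.
Qed.

Lemma linear_family_continuous q h z v z0 v0 :
  param_continuous T q -> param_continuous T h -> linear_family q h z v ->
  (forall p, z 0 p = z0 /\ v 0 p = v0) ->
  param_continuous T z /\ param_continuous T v.
Proof.
intros Hq Hh Hs Hi.
assert (Hloc : forall p eps, 0 < eps ->
  locally p (fun p' => forall t, 0 <= t <= T ->
    Rabs (z t p' - z t p) <= eps /\ Rabs (v t p' - v t p) <= eps)).
{ intros p eps He.
  destruct (uniform_bound q p Hq) as [L [HL1 [HL2 HL3]]].
  destruct (bounded_on_segment T (fun s => z s p) HT
    (proj1 (solution_continuous _ _ _ _ (Hs p)))) as [Z [HZ0 HZ]].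
  assert (HC := gronwall_constant_pos L). set (C := gronwall_constant L T) in *.
  destruct (small_factor (C * (1 + Z)) eps) as [d [Hd [Hd1 Hde]]];
    [apply Rmult_le_pos; lra|auto|].
  generalize (filter_and _ _ HL3 (filter_and _ _ (proj2 Hq p _ Hd) (proj2 Hh p _ Hd))).
  apply filter_imp. intros p' [HL [A B]] t Ht.
  assert (Hdz : 0 <= d * (1 + Z)) by (apply Rmult_le_pos; lra).
  assert (G := linear_family_gronwall q h z v (fun t => z t p) (fun t => v t p)
    (fun t => h t p) p p' 0 L (d * (1 + Z)) Hs (Hs p)).
  destruct (Hi p) as [E1 E2]. destruct (Hi p') as [E3 E4].
  rewrite E1, E2, E3, E4 in G.
  specialize (G ltac:(ring) ltac:(ring) Hdz HL1 HL2 HL).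
  assert (G' : Rabs (z t p' - z t p - 0 * z t p) <= C * (d * (1 + Z)) /\
               Rabs (v t p' - v t p - 0 * v t p) <= C * (d * (1 + Z))).
  { apply G; auto. intros s Hs'.
    specialize (A s Hs'). specialize (B s Hs'). specialize (HZ s Hs').
    replace (h s p' - h s p - 0 * h s p - (q s p' - q s p) * (z s p + 0 * z s p))
      with ((h s p' - h s p) + - ((q s p' - q s p) * z s p)) by ring.
    eapply Rle_trans; [apply Rabs_triang|]. rewrite Rabs_Ropp, Rabs_mult.
    assert (Rabs (q s p' - q s p) * Rabs (z s p) <= d * Z)
      by (apply Rmult_le_compat; auto; apply Rabs_pos). lra. }
  rewrite !Rmult_0_l, !Rminus_0_r in G'. destruct G'. split; lra. }
split; split.
- intros p. apply (solution_continuous _ _ _ _ (Hs p)).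
- intros p eps He. generalize (Hloc p eps He). apply filter_imp.
  intros p' A t Ht. apply A, Ht.
- intros p. apply (solution_continuous _ _ _ _ (Hs p)).
- intros p eps He. generalize (Hloc p eps He). apply filter_imp.
  intros p' A t Ht. apply A, Ht.
Qed.

(** The solution [w], [u] of the equation obtained by formal differentiation is the
    derivative of the solution [z], [v]. *)
Lemma linear_family_derivative i q h q1 h1 z v z0 v0 w u :
  param_continuous T q -> linear_family q h z v ->
  (forall p, z 0 p = z0 /\ v 0 p = v0) ->
  param_derivative T i q q1 -> param_derivative T i h h1 ->
  linear_family q (fun t p => h1 t p + - 1 * (q1 t p * z t p)) w u ->
  (forall p, w 0 p = 0 /\ u 0 p = 0) ->
  param_derivative T i z w /\ param_derivative T i v u.
Proof.
intros Hq Hs Hi Hq1 Hh1 Hs' Hi'.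
assert (Hloc : forall p eps, 0 < eps ->
  locally 0 (fun k => forall t, 0 <= t <= T ->
    Rabs (z t (shift i k p) - z t p - k * w t p) <= eps * Rabs k /\
    Rabs (v t (shift i k p) - v t p - k * u t p) <= eps * Rabs k)).
{ intros p eps He.
  destruct (uniform_bound q p Hq) as [L [HL1 [HL2 HL3]]].
  destruct (bounded_on_segment T (fun s => z s p) HT
    (proj1 (solution_continuous _ _ _ _ (Hs p)))) as [Z [HZ0 HZ]].
  destruct (bounded_on_segment T (fun s => w s p) HT
    (proj1 (solution_continuous _ _ _ _ (Hs' p)))) as [W [HW0 HW]].
  assert (HC := gronwall_constant_pos L). set (C := gronwall_constant L T) in *.
  destruct (small_factor (C * (1 + Z + W)) eps) as [d [Hd [Hd1 Hde]]];
    [apply Rmult_le_pos; lra|auto|].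
  generalize (filter_and _ _ (locally_shift i p _ (filter_and _ _ HL3 (proj2 Hq p _ Hd)))
    (filter_and _ _ (Hq1 p _ Hd) (Hh1 p _ Hd))).
  apply filter_imp. intros k [[HL D] [A B]] t Ht.
  set (p' := shift i k p) in *.
  assert (Hk0 := Rabs_pos k).
  assert (Hdz : 0 <= d * (1 + Z + W) * Rabs k)
    by (apply Rmult_le_pos; auto; apply Rmult_le_pos; lra).
  assert (G := linear_family_gronwall q h z v (fun t => w t p) (fun t => u t p)
    (fun t => h1 t p + - 1 * (q1 t p * z t p)) p p' k L (d * (1 + Z + W) * Rabs k) Hs (Hs' p)).
  destruct (Hi p) as [E1 E2]. destruct (Hi p') as [E3 E4]. destruct (Hi' p) as [E5 E6].
  rewrite E1, E2, E3, E4, E5, E6 in G.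
  specialize (G ltac:(ring) ltac:(ring) Hdz HL1 HL2 HL).
  assert (G' : Rabs (z t p' - z t p - k * w t p) <= C * (d * (1 + Z + W) * Rabs k) /\
               Rabs (v t p' - v t p - k * u t p) <= C * (d * (1 + Z + W) * Rabs k)).
  { apply G; auto. intros s Hs1.
    specialize (A s Hs1). specialize (B s Hs1). specialize (D s Hs1).
    specialize (HZ s Hs1). specialize (HW s Hs1).
    replace (h s p' - h s p - k * (h1 s p + -1 * (q1 s p * z s p))
             - (q s p' - q s p) * (z s p + k * w s p))
      with ((h s p' - h s p - k * h1 s p)
            + - ((q s p' - q s p - k * q1 s p) * z s p)
            + - ((q s p' - q s p) * w s p * k)) by ring.
    eapply Rle_trans; [apply Rabs_triang|].
    eapply Rle_trans; [apply Rplus_le_compat_r, Rabs_triang|].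
    rewrite !Rabs_Ropp, !Rabs_mult.
    assert (Rabs (q s p' - q s p - k * q1 s p) * Rabs (z s p) <= d * Rabs k * Z)
      by (apply Rmult_le_compat; auto; apply Rabs_pos).
    assert (Rabs (q s p' - q s p) * Rabs (w s p) <= d * W)
      by (apply Rmult_le_compat; auto; apply Rabs_pos).
    assert (Rabs (q s p' - q s p) * Rabs (w s p) * Rabs k <= d * W * Rabs k)
      by (apply Rmult_le_compat_r; auto).
    lra. }
  assert (d * (C * (1 + Z + W)) * Rabs k <= eps * Rabs k)
    by (apply Rmult_le_compat_r; auto).
  destruct G'. split; lra. }
split; intros p eps He; generalize (Hloc p eps He); apply filter_imp;
  intros k A t Ht; apply A, Ht.
Qed.

(** The formal derivative solves an equation with the same [q] and a force that
    loses one order of smoothness, whence an induction on the order. *)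
Lemma linear_family_Cn n q h z v z0 v0 :
  param_Cn T n q -> param_Cn T n h -> linear_family q h z v ->
  (forall p, z 0 p = z0 /\ v 0 p = v0) ->
  param_Cn T n z /\ param_Cn T n v.
Proof.
revert q h z v z0 v0. induction n as [|n IH]; intros q h z v z0 v0 Hq Hh Hs Hi;
  destruct (linear_family_continuous q h z v z0 v0 (param_Cn_continuous _ _ _ Hq)
              (param_Cn_continuous _ _ _ Hh) Hs Hi) as [Hz Hv].
- now split.
- assert (HqS := param_Cn_S _ _ _ Hq). assert (HhS := param_Cn_S _ _ _ Hh).
  destruct (IH q h z v z0 v0 HqS HhS Hs Hi) as [HzS HvS].
  assert (Hd : forall i, exists w u,
    (param_derivative T i z w /\ param_derivative T i v u) /\
    (param_Cn T n w /\ param_Cn T n u)).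
  { intros i. destruct (proj2 Hq i) as [q1 [Hq1 Hq1n]].
    destruct (proj2 Hh i) as [h1 [Hh1 Hh1n]].
    set (r := fun t p => h1 t p + - 1 * (q1 t p * z t p)).
    assert (Hr : param_Cn T n r).
    { apply param_Cn_plus; auto.
      apply (param_Cn_scal T n (- 1) (fun t p => q1 t p * z t p)); auto.
      now apply param_Cn_mult. }
    set (w := fun t p => sol1 (velocity kappa)
      (linear_force g (fun t => q t p) (fun t => r t p)) (0, 0) t).
    set (u := fun t p => sol2 (velocity kappa)
      (linear_force g (fun t => q t p) (fun t => r t p)) (0, 0) t).
    assert (Hwu : forall p, planar_solution (velocity kappa)
      (linear_force g (fun t => q t p) (fun t => r t p))
      (fun t => w t p) (fun t => u t p) /\ w 0 p = 0 /\ u 0 p = 0).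
    { intros p. apply linear_solution_exists; auto.
      - apply (param_Cn_continuous _ _ _ Hq).
      - apply (param_Cn_continuous _ _ _ Hr). }
    exists w, u. split.
    - apply (linear_family_derivative i q h q1 h1 z v z0 v0); auto.
      + apply (param_Cn_continuous _ _ _ Hq).
      + intros p. apply Hwu.
      + intros p. apply Hwu.
    - apply (IH q r w u 0 0); auto.
      + intros p. apply Hwu.
      + intros p. apply Hwu. }
  split; (split; [assumption|]); intros i;
    destruct (Hd i) as [w [u [[H1 H2] [H3 H4]]]]; [exists w|exists u]; auto.
Qed.

End LinearDependence.

(** * The flow of a damped and forced pendulum *)

(** The force [y' = - g y + c - b sin (2 x - psi)], with damping [g]. *)
Definition pendulum_force (g c b psi : R -> R) (t x y : R) : R :=
  - g t * y + c t - b t * sin (2 * x - psi t).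

(** The state at time [t] of the solution with initial value [p]. *)
Definition pendulum_flow1 kappa g c b psi (t : R) (p : R * R) : R :=
  sol1 (velocity kappa) (pendulum_force g c b psi) p t.

Definition pendulum_flow2 kappa g c b psi (t : R) (p : R * R) : R :=
  sol2 (velocity kappa) (pendulum_force g c b psi) p t.

(** The map from the state at time [0] to the state at time [T]. *)
Definition pendulum_map kappa g c b psi (T : R) (p : R * R) : R * R :=
  (pendulum_flow1 kappa g c b psi T p, pendulum_flow2 kappa g c b psi T p).

Lemma sin_period_Z (x : R) (k : Z) : sin (x + IZR k * (2 * PI)) = sin x.
Proof.
assert (Hn : forall n y, sin (y + INR n * (2 * PI)) = sin y).
{ intros n y. rewrite <- (sin_period y n). f_equal. ring. }
destruct (Z_le_gt_dec 0 k) as [Hk|Hk].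
- rewrite <- (Z2Nat.id k Hk), <- INR_IZR_INZ. apply Hn.
- rewrite <- (Hn (Z.to_nat (- k)) (x + IZR k * (2 * PI))).
  f_equal. rewrite INR_IZR_INZ, Z2Nat.id by lia. rewrite opp_IZR. ring.
Qed.

Section Pendulum.

Variables (T kappa : R) (g c b psi : R -> R).
Hypotheses (HT : 0 < T) (Hg : forall t, continuous g t) (Hc : forall t, continuous c t)
  (Hb : forall t, continuous b t) (Hpsi : forall t, continuous psi t).

Let solution := planar_solution (velocity kappa) (pendulum_force g c b psi).
Let phi := pendulum_flow1 kappa g c b psi.
Let nu := pendulum_flow2 kappa g c b psi.

Lemma pendulum_flow_solution p :
  solution (fun t => phi t p) (fun t => nu t p) /\ phi 0 p = fst p /\ nu 0 p = snd p.
Proof.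
apply (picard_lindelof _ _ (fun t => Rabs kappa + (Rabs (g t) + 2 * Rabs (b t)))).
- apply velocity_continuous.
- intros x y Hx Hy t. unfold pendulum_force.
  apply (continuous_minus (fun s => - g s * y s + c s)
           (fun s => b s * sin (2 * x s - psi s))).
  + apply (continuous_Rplus (fun s => - g s * y s)); auto.
    apply (continuous_Rmult (fun s => - g s)); auto. now apply continuous_Ropp.
  + apply (continuous_Rmult b); auto. apply continuous_sin_fct.
    apply (continuous_minus (fun s => 2 * x s) psi); auto.
    apply (continuous_Rmult (fun _ => 2)); auto. apply continuous_const.
- intros t. apply (continuous_Rplus (fun _ => Rabs kappa)); [apply continuous_const|].
  apply continuous_Rplus; [now apply continuous_Rabs_fct|].
  apply (continuous_Rmult (fun _ => 2)); [apply continuous_const|].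
  now apply continuous_Rabs_fct.
- intros t x y x' y'. unfold velocity, pendulum_force.
  replace (kappa * y - kappa * y') with (kappa * (y - y')) by ring.
  replace (- g t * y + c t - b t * sin (2 * x - psi t)
           - (- g t * y' + c t - b t * sin (2 * x' - psi t)))
    with (- (g t * (y - y') + b t * (sin (2 * x - psi t) - sin (2 * x' - psi t)))) by ring.
  rewrite Rabs_Ropp.
  assert (A := Rabs_triang (g t * (y - y'))
                 (b t * (sin (2 * x - psi t) - sin (2 * x' - psi t)))).
  assert (B := sin_lipschitz (2 * x' - psi t) (2 * x - psi t)).
  replace (2 * x - psi t - (2 * x' - psi t)) with (2 * (x - x')) in B by ring.
  rewrite !Rabs_mult in *. rewrite (Rabs_pos_eq 2) in B by lra.
  assert (P1 := Rabs_pos kappa). assert (P2 := Rabs_pos (g t)).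
  assert (P3 := Rabs_pos (b t)). assert (P4 := Rabs_pos (x - x')).
  assert (P5 := Rabs_pos (y - y')).
  assert (C := Rmult_le_compat_l _ _ _ P3 B).
  split; nra.
Qed.

Lemma pendulum_bound :
  exists L, Rabs kappa <= L /\ (forall t, 0 <= t <= T -> Rabs (g t) <= L) /\
    (forall t, 0 <= t <= T -> 2 * Rabs (b t) <= L).
Proof.
destruct (bounded_on_segment T g (Rlt_le _ _ HT) Hg) as [G [HG0 HG]].
destruct (bounded_on_segment T b (Rlt_le _ _ HT) Hb) as [B [HB0 HB]].
exists (Rabs kappa + G + 2 * B). assert (A := Rabs_pos kappa). repeat split.
- lra.
- intros t Ht. specialize (HG t Ht). lra.
- intros t Ht. specialize (HB t Ht). lra.
Qed.

Lemma pendulum_gronwall L x y x' y' eps :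
  Rabs kappa <= L -> (forall t, 0 <= t <= T -> Rabs (g t) <= L) ->
  (forall t, 0 <= t <= T -> 2 * Rabs (b t) <= L) ->
  solution x y -> solution x' y' ->
  Rabs (x' 0 - x 0) <= eps -> Rabs (y' 0 - y 0) <= eps ->
  forall t, 0 <= t <= T ->
    Rabs (x' t - x t) <= gronwall_constant L T * eps /\
    Rabs (y' t - y t) <= gronwall_constant L T * eps.
Proof.
intros HkL HgL HbL Hs Hs' Hx0 Hy0.
assert (Heps : 0 <= eps) by (eapply Rle_trans; [apply Rabs_pos|apply Hx0]).
apply (gronwall T L eps kappa (fun t => x' t - x t) (fun t => y' t - y t)
  (fun t => pendulum_force g c b psi t (x' t) (y' t)
            - pendulum_force g c b psi t (x t) (y t))); auto.
- eapply Rle_trans; [apply Rabs_pos|apply HkL].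
- intros t. rewrite Rmult_minus_distr_l.
  apply (is_derive_minus x' x); [apply Hs'|apply Hs].
- intros t. apply (is_derive_minus y' y); [apply Hs'|apply Hs].
- intros t Ht. unfold pendulum_force.
  replace (- g t * y' t + c t - b t * sin (2 * x' t - psi t)
           - (- g t * y t + c t - b t * sin (2 * x t - psi t)))
    with (- (g t * (y' t - y t)
             + b t * (sin (2 * x' t - psi t) - sin (2 * x t - psi t)))) by ring.
  rewrite Rabs_Ropp. eapply Rle_trans; [apply Rabs_triang|]. rewrite !Rabs_mult.
  assert (B := sin_lipschitz (2 * x t - psi t) (2 * x' t - psi t)).
  replace (2 * x' t - psi t - (2 * x t - psi t)) with (2 * (x' t - x t)) in B by ring.
  rewrite Rabs_mult, (Rabs_pos_eq 2) in B by lra.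
  specialize (HgL t Ht). specialize (HbL t Ht).
  assert (P3 := Rabs_pos (b t)). assert (P4 := Rabs_pos (x' t - x t)).
  assert (P5 := Rabs_pos (y' t - y t)).
  assert (C := Rmult_le_compat_l _ _ _ P3 B). nra.
Qed.

(** The flow accounts for all solutions on [[0, T]]. *)
Lemma pendulum_unique x y p :
  solution x y -> (x 0, y 0) = p ->
  forall t, 0 <= t <= T -> x t = phi t p /\ y t = nu t p.
Proof.
intros Hs Hp t Ht. destruct pendulum_bound as [L [H1 [H2 H3]]].
destruct (pendulum_flow_solution p) as [Hf [Hx Hy]]. subst p. simpl in Hx, Hy.
assert (A := pendulum_gronwall L _ _ x y 0 H1 H2 H3 Hf Hs).
cbv beta in A. rewrite Hx, Hy, !Rminus_diag, Rabs_R0 in A.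
specialize (A (Rle_refl 0) (Rle_refl 0) t Ht). rewrite Rmult_0_r in A.
destruct A as [A B].
split; apply Rminus_diag_uniq, eq_0_of_abs_le; intros; lra.
Qed.

Lemma pendulum_time_map :
  time_map solution 0 T (pendulum_map kappa g c b psi T).
Proof.
intros p. split.
- destruct (pendulum_flow_solution p) as [Hs [Hx Hy]].
  exists (fun t => phi t p), (fun t => nu t p). split; auto.
  rewrite Hx, Hy. now destruct p.
- intros x y Hs Hp. destruct (pendulum_unique x y p Hs Hp T) as [H1 H2]; [lra|].
  unfold pendulum_map. fold (phi T p) (nu T p). now rewrite H1, H2.
Qed.

Lemma pendulum_continuous : param_continuous T phi /\ param_continuous T nu.
Proof.
destruct pendulum_bound as [L [H1 [H2 H3]]].
assert (HC := gronwall_constant_pos T L).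
assert (Hloc : forall p eps, 0 < eps ->
  locally p (fun p' => forall t, 0 <= t <= T ->
    Rabs (phi t p' - phi t p) <= eps /\ Rabs (nu t p' - nu t p) <= eps)).
{ intros p eps He.
  assert (Hd : 0 < eps / gronwall_constant L T) by (apply Rdiv_lt_0_compat; auto).
  exists (mkposreal _ Hd). intros p' [Hp1 Hp2] t Ht.
  destruct (pendulum_flow_solution p) as [Hs [Hx Hy]].
  destruct (pendulum_flow_solution p') as [Hs' [Hx' Hy']].
  assert (Hp1' : Rabs (phi 0 p' - phi 0 p) <= eps / gronwall_constant L T)
    by (rewrite Hx, Hx'; apply Rlt_le; exact Hp1).
  assert (Hp2' : Rabs (nu 0 p' - nu 0 p) <= eps / gronwall_constant L T)
    by (rewrite Hy, Hy'; apply Rlt_le; exact Hp2).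
  assert (A := pendulum_gronwall L _ _ _ _ _ H1 H2 H3 Hs Hs' Hp1' Hp2' t Ht).
  replace (gronwall_constant L T * (eps / gronwall_constant L T)) with eps in A
    by (field; lra).
  exact A. }
split; split.
- intros p. apply (solution_continuous _ _ _ _ (proj1 (pendulum_flow_solution p))).
- intros p eps He. generalize (Hloc p eps He). apply filter_imp.
  intros p' A t Ht. apply A, Ht.
- intros p. apply (solution_continuous _ _ _ _ (proj1 (pendulum_flow_solution p))).
- intros p eps He. generalize (Hloc p eps He). apply filter_imp.
  intros p' A t Ht. apply A, Ht.
Qed.

(** The coefficient [2 b cos (2 phi - psi)] of the variational equation along the
    solution with initial value [p]; the cosine is written as a sine. *)
Definition variation_coefficient (t : R) (p : R * R) : R :=
  2 * b t * sin (PI / 2 + (2 * phi t p + - psi t)).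

Definition variational_force (p : R * R) : R -> R -> R -> R :=
  linear_force g (fun t => variation_coefficient t p) (fun _ => 0).

(** The column of the fundamental matrix of the variational equation whose initial
    value is the unit vector in the direction [i]. *)
Definition variation1 (i : bool) (t : R) (p : R * R) : R :=
  sol1 (velocity kappa) (variational_force p) (shift i 1 (0, 0)) t.

Definition variation2 (i : bool) (t : R) (p : R * R) : R :=
  sol2 (velocity kappa) (variational_force p) (shift i 1 (0, 0)) t.

Lemma variation_coefficient_Cn n :
  param_Cn T n phi -> param_Cn T n variation_coefficient.
Proof.
intros H. assert (HT' := Rlt_le _ _ HT).
apply (param_Cn_mult T n (fun t _ => 2 * b t)); auto.
{ apply (param_Cn_cst T n (fun t => 2 * b t)). intros t.
  apply (continuous_Rmult (fun _ => 2)); auto. apply continuous_const. }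
apply (param_Cn_sin T n (fun t p => PI / 2 + (2 * phi t p + - psi t))); auto.
apply (param_Cn_plus T n (fun _ _ => PI / 2)).
{ apply (param_Cn_cst T n (fun _ => PI / 2)). intros t. apply continuous_const. }
apply (param_Cn_plus T n (fun t p => 2 * phi t p) (fun t _ => - psi t)).
- now apply param_Cn_scal.
- apply (param_Cn_cst T n (fun t => - psi t)). intros t. now apply continuous_Ropp.
Qed.

Lemma variation_solution i p :
  planar_solution (velocity kappa) (variational_force p)
    (fun t => variation1 i t p) (fun t => variation2 i t p) /\
  variation1 i 0 p = fst (shift i 1 (0, 0)) /\
  variation2 i 0 p = snd (shift i 1 (0, 0)).
Proof.
apply linear_solution_exists; auto.
- apply (param_Cn_continuous T 0). apply variation_coefficient_Cn.
  split; auto. apply pendulum_continuous.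
- intros t. apply continuous_const.
Qed.

(** The flow is Lipschitz in the initial value, so that the remainder of the
    first-order expansion of the sine is of second order in the increment. *)
Lemma pendulum_derivative i :
  param_derivative T i phi (variation1 i) /\ param_derivative T i nu (variation2 i).
Proof.
destruct pendulum_bound as [L [H1 [H2 H3]]].
assert (HL : 0 <= L) by (eapply Rle_trans; [apply Rabs_pos|apply H1]).
assert (HC := gronwall_constant_pos T L). set (C := gronwall_constant L T) in *.
assert (Hloc : forall p eps, 0 < eps ->
  locally 0 (fun k => forall t, 0 <= t <= T ->
    Rabs (phi t (shift i k p) - phi t p - k * variation1 i t p) <= eps * Rabs k /\
    Rabs (nu t (shift i k p) - nu t p - k * variation2 i t p) <= eps * Rabs k)).
{ intros p eps He.
  destruct (small_factor (C * (2 * L * C ^ 2)) eps) as [d [Hd [Hd1 Hde]]]; auto.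
  { apply Rmult_le_pos; [lra|]. apply Rmult_le_pos; [lra|apply pow2_ge_0]. }
  generalize (locally_0_lt d Hd). apply filter_imp. intros k Hk t Ht.
  set (p' := shift i k p).
  destruct (pendulum_flow_solution p) as [Hs [Hx Hy]].
  destruct (pendulum_flow_solution p') as [Hs' [Hx' Hy']].
  destruct (variation_solution i p) as [Hw [Hw0 Hu0]].
  assert (Hk0 := Rabs_pos k).
  assert (Hlip : forall s, 0 <= s <= T -> Rabs (phi s p' - phi s p) <= C * Rabs k).
  { intros s Hs1.
    apply (pendulum_gronwall L _ _ _ _ (Rabs k) H1 H2 H3 Hs Hs'); auto;
      rewrite ?Hx, ?Hx', ?Hy, ?Hy'; unfold p', shift; destruct i; simpl;
      rewrite ?Rplus_minus_l, ?Rminus_diag, ?Rabs_R0; auto; apply Rle_refl. }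
  assert (G : Rabs (phi t p' - phi t p - k * variation1 i t p)
                <= C * (2 * L * C ^ 2 * Rabs k ^ 2) /\
              Rabs (nu t p' - nu t p - k * variation2 i t p)
                <= C * (2 * L * C ^ 2 * Rabs k ^ 2)).
  { assert (He0 : 0 <= 2 * L * C ^ 2 * Rabs k ^ 2).
    { apply Rmult_le_pos; [|apply pow2_ge_0].
      apply Rmult_le_pos; [lra|apply pow2_ge_0]. }
    assert (Hi0 : phi 0 p' - phi 0 p - k * variation1 i 0 p = 0 /\
                  nu 0 p' - nu 0 p - k * variation2 i 0 p = 0).
    { rewrite Hx, Hx', Hy, Hy', Hw0, Hu0. unfold p', shift.
      destruct i; simpl; split; ring. }
    set (D := fun s => phi s p' - phi s p - k * variation1 i s p).
    set (V := fun s => nu s p' - nu s p - k * variation2 i s p).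
    set (S := fun s => 2 * phi s p - psi s).
    set (S' := fun s => 2 * phi s p' - psi s).
    apply (gronwall T L _ kappa D V
      (fun s => - g s * V s - 2 * b s * cos (S s) * D s
                - b s * (sin (S' s) - sin (S s) - cos (S s) * (S' s - S s)))); auto.
    - intros s. apply (is_derive_first_order_remainder _ _ _ k s _ _ _ _
        (proj1 (Hs' s)) (proj1 (Hs s)) (proj1 (Hw s))). unfold velocity, V. ring.
    - intros s. apply (is_derive_first_order_remainder _ _ _ k s _ _ _ _
        (proj2 (Hs' s)) (proj2 (Hs s)) (proj2 (Hw s))).
      unfold pendulum_force, variational_force, linear_force, variation_coefficient.
      rewrite <- cos_sin. unfold D, V, S, S'.
      replace (2 * phi s p + - psi s) with (2 * phi s p - psi s) by ring. ring.
    - intros s Hs1.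
      assert (T1 := sin_first_order (S s) (S' s)).
      replace (S' s - S s) with (2 * (phi s p' - phi s p)) in * by (unfold S, S'; ring).
      set (r := sin (S' s) - sin (S s) - cos (S s) * (2 * (phi s p' - phi s p))) in *.
      rewrite (Rabs_mult 2), (Rabs_pos_eq 2) in T1 by lra.
      specialize (Hlip s Hs1). specialize (H2 s Hs1). specialize (H3 s Hs1).
      assert (T2 : (2 * Rabs (phi s p' - phi s p)) ^ 2 <= (2 * (C * Rabs k)) ^ 2).
      { apply pow_incr. assert (A := Rabs_pos (phi s p' - phi s p)). lra. }
      assert (T3 : Rabs r <= 4 * C ^ 2 * Rabs k ^ 2) by lra.
      assert (Hb0 := Rabs_pos (b s)).
      assert (T4 : Rabs (b s) * Rabs r <= L / 2 * (4 * C ^ 2 * Rabs k ^ 2))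
        by (apply Rmult_le_compat; auto; try apply Rabs_pos; lra).
      assert (Hcos : Rabs (cos (S s)) <= 1) by (apply Rabs_le_between, COS_bound).
      assert (T5 : 2 * Rabs (b s) * Rabs (cos (S s)) <= L * 1)
        by (apply Rmult_le_compat; auto; try apply Rabs_pos; lra).
      assert (T6 : 2 * Rabs (b s) * Rabs (cos (S s)) * Rabs (D s) <= L * 1 * Rabs (D s))
        by (apply Rmult_le_compat_r; auto; apply Rabs_pos).
      assert (T7 : Rabs (g s) * Rabs (V s) <= L * Rabs (V s))
        by (apply Rmult_le_compat_r; auto; apply Rabs_pos).
      replace (- g s * V s - 2 * b s * cos (S s) * D s - b s * r)
        with (- (g s * V s) + - (2 * b s * cos (S s) * D s) + - (b s * r)) by ring.
      eapply Rle_trans; [apply Rabs_triang|].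
      eapply Rle_trans; [apply Rplus_le_compat_r, Rabs_triang|].
      rewrite !Rabs_Ropp, !Rabs_mult, (Rabs_pos_eq 2) by lra. lra.
    - unfold D. now rewrite (proj1 Hi0), Rabs_R0.
    - unfold V. now rewrite (proj2 Hi0), Rabs_R0. }
  assert (E : C * (2 * L * C ^ 2 * Rabs k ^ 2) <= eps * Rabs k).
  { replace (C * (2 * L * C ^ 2 * Rabs k ^ 2))
      with (Rabs k * (C * (2 * L * C ^ 2)) * Rabs k) by ring.
    apply Rmult_le_compat_r; auto. eapply Rle_trans; [|apply Hde].
    apply Rmult_le_compat_r; [|lra].
    apply Rmult_le_pos; [lra|]. apply Rmult_le_pos; [lra|apply pow2_ge_0]. }
  destruct G. split; lra. }
split; intros p eps He; generalize (Hloc p eps He); apply filter_imp;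
  intros k A t Ht; apply A, Ht.
Qed.

(** If the flow is of class C^n, so is the coefficient of the variational equation,
    hence also the derivative of the flow. *)
Lemma pendulum_Cn n : param_Cn T n phi /\ param_Cn T n nu.
Proof.
induction n as [|n IH].
- split; split; auto; apply pendulum_continuous.
- assert (HV : forall i, param_Cn T n (variation1 i) /\ param_Cn T n (variation2 i)).
  { intros i. apply (linear_family_Cn T kappa g (Rlt_le _ _ HT) Hg n
      variation_coefficient (fun _ _ => 0) _ _
      (fst (shift i 1 (0, 0))) (snd (shift i 1 (0, 0)))).
    - now apply variation_coefficient_Cn.
    - apply (param_Cn_cst T n (fun _ => 0)). intros t. apply continuous_const.
    - intros p. apply variation_solution.
    - intros p. apply variation_solution. }
  split; (split; [apply pendulum_continuous|]); intros i.
  + exists (variation1 i). split; [apply pendulum_derivative|apply HV].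
  + exists (variation2 i). split; [apply pendulum_derivative|apply HV].
Qed.

(** Liouville's formula: the determinant of the fundamental matrix solves
    [D' = - g D]. *)
Lemma variation_determinant (Gamma : R -> R) p :
  (forall t, is_derive Gamma t (g t)) ->
  variation1 true T p * variation2 false T p
  - variation1 false T p * variation2 true T p = exp (- (Gamma T - Gamma 0)).
Proof.
intros HG.
destruct (variation_solution true p) as [H1 [I1 I1']].
destruct (variation_solution false p) as [H2 [I2 I2']].
unfold shift in I1, I1', I2, I2'. simpl in I1, I1', I2, I2'.
set (w1 := fun t => variation1 true t p) in *. set (u1 := fun t => variation2 true t p) in *.
set (w2 := fun t => variation1 false t p) in *. set (u2 := fun t => variation2 false t p) in *.
set (f := fun t => (w1 t * u2 t - w2 t * u1 t) * exp (Gamma t)).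
assert (Hf : f 0 = f T).
{ apply (eq_is_derive f 0 T); auto. intros t _. unfold f. auto_derive.
  - repeat split; eexists; [apply H1|apply H2|apply H2|apply H1|apply HG].
  - replace (Derive (fun x => w1 x) t) with (velocity kappa t (w1 t) (u1 t))
      by (symmetry; apply is_derive_unique, H1).
    replace (Derive (fun x => w2 x) t) with (velocity kappa t (w2 t) (u2 t))
      by (symmetry; apply is_derive_unique, H2).
    replace (Derive (fun x => u1 x) t) with (variational_force p t (w1 t) (u1 t))
      by (symmetry; apply is_derive_unique, H1).
    replace (Derive (fun x => u2 x) t) with (variational_force p t (w2 t) (u2 t))
      by (symmetry; apply is_derive_unique, H2).
    replace (Derive (fun x => Gamma x) t) with (g t)
      by (symmetry; apply is_derive_unique, HG).
    unfold velocity, variational_force, linear_force.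
    change (@zero R_NormedModule) with 0. ring. }
unfold f in Hf. unfold w1, w2, u1, u2 in Hf. rewrite I1, I1', I2, I2' in Hf.
replace (- (Gamma T - Gamma 0)) with (Gamma 0 + - Gamma T) by ring.
rewrite exp_plus, exp_Ropp.
assert (Hp := exp_pos (Gamma T)).
apply (Rmult_eq_reg_r (exp (Gamma T))); [|lra].
rewrite <- Hf. field. lra.
Qed.

Lemma pendulum_pullback (Gamma : R -> R) :
  (forall t, is_derive Gamma t (g t)) ->
  forall p v w, pullback (pendulum_map kappa g c b psi T) Omega p v w
                = exp (- (Gamma T - Gamma 0)) * Omega p v w.
Proof.
intros HG p v w. assert (HTT : 0 <= T <= T) by lra.
rewrite <- (variation_determinant Gamma p HG).
assert (E : forall v, differential (pendulum_map kappa g c b psi T) p v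
  = (variation1 true T p * fst v + variation1 false T p * snd v,
     variation2 true T p * fst v + variation2 false T p * snd v)).
{ intros v'. destruct p as [x y].
  unfold differential, partial1, partial2, pendulum_map. simpl. fold phi nu.
  f_equal; f_equal; f_equal; apply is_derive_unique.
  - apply (param_derivative_partial1 T phi); auto. apply pendulum_derivative.
  - apply (param_derivative_partial2 T phi); auto. apply pendulum_derivative.
  - apply (param_derivative_partial1 T nu); auto. apply pendulum_derivative.
  - apply (param_derivative_partial2 T nu); auto. apply pendulum_derivative. }
unfold pullback, Omega. rewrite !E. simpl. ring.
Qed.

(** Compatibility with the identification of angles modulo [2 PI] follows from
    uniqueness, since a translate of a solution by a multiple of [2 PI] is again a
    solution. *)
Lemma pendulum_smooth : smooth_phase_map (pendulum_map kappa g c b psi T).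
Proof.
split; [|split].
- intros p q [[k Hk] Hy].
  destruct (pendulum_flow_solution p) as [Hs [Hx0 Hy0]].
  assert (Hs' : solution (fun t => phi t p + IZR k * (2 * PI)) (fun t => nu t p)).
  { intros t. destruct (Hs t) as [A B]. split.
    - rewrite <- (Rplus_0_r (velocity _ _ _ _)).
      apply (is_derive_plus (fun s => phi s p) (fun _ => IZR k * (2 * PI))); auto.
      apply (is_derive_const (IZR k * (2 * PI))).
    - evar_last; [apply B|]. unfold pendulum_force.
      replace (2 * (phi t p + IZR k * (2 * PI)) - psi t)
        with ((2 * phi t p - psi t) + IZR (2 * k) * (2 * PI)) by (rewrite mult_IZR; ring).
      now rewrite sin_period_Z. }
  destruct (pendulum_unique _ _ q Hs') with T as [A B].
  + rewrite Hx0, Hy0, <- Hk, <- Hy. now destruct q.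
  + lra.
  + split; simpl; [exists k|]; symmetry; assumption.
- intros n x y. apply (param_Cn_ex_diff_n T n phi T); [lra|]. apply pendulum_Cn.
- intros n x y. apply (param_Cn_ex_diff_n T n nu T); [lra|]. apply pendulum_Cn.
Qed.

End Pendulum.

(** Reversing time turns solutions into solutions. *)
Lemma pendulum_reverse (T kappa kappa' : R) (g c b psi g' c' b' psi' x y : R -> R) :
  kappa' = - kappa ->
  (forall t, g' t = - g (T - t)) -> (forall t, c' t = - c (T - t)) ->
  (forall t, b' t = - b (T - t)) -> (forall t, psi' t = psi (T - t)) ->
  planar_solution (velocity kappa) (pendulum_force g c b psi) x y ->
  planar_solution (velocity kappa') (pendulum_force g' c' b' psi')
    (fun t => x (T - t)) (fun t => y (T - t)).
Proof.
intros -> Hg Hc Hb Hpsi Hs t.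
assert (Hrev : forall f l, is_derive f (T - t) l -> is_derive (fun s => f (T - s)) t (- l)).
{ intros f l Hf. evar_last.
  - apply (is_derive_comp f (fun s => T - s) t l (- 1)); auto.
    auto_derive; [trivial|ring].
  - change (- 1 * l = - l). ring. }
destruct (Hs (T - t)) as [A B]. split.
- evar_last; [apply Hrev, A|]. unfold velocity. ring.
- evar_last; [apply Hrev, B|]. unfold pendulum_force.
  rewrite Hg, Hc, Hb, Hpsi. ring.
Qed.

Lemma time_map_inverse (solution solution' : (R -> R) -> (R -> R) -> Prop) (T : R) P Q :
  (forall x y, solution x y -> solution' (fun t => x (T - t)) (fun t => y (T - t))) ->
  time_map solution 0 T P -> time_map solution' 0 T Q -> forall p, Q (P p) = p.
Proof.
intros Hrev HP HQ p. destruct (HP p) as [[x [y [Hs Hp]]] Huniq].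
rewrite (Huniq x y Hs Hp).
rewrite (proj2 (HQ _) _ _ (Hrev x y Hs)); rewrite ?Rminus_0_r, ?Rminus_diag; auto.
Qed.

(** The inverse of the map is the map of the time-reversed equation. *)
Theorem pendulum_conformally_symplectic (T : R) (g c b psi Gamma : R -> R) :
  0 < T ->
  (forall t, continuous g t) -> (forall t, continuous c t) ->
  (forall t, continuous b t) -> (forall t, continuous psi t) ->
  (forall t, is_derive Gamma t (g t)) ->
  exists P, time_map (planar_solution (velocity 1) (pendulum_force g c b psi)) 0 T P /\
    conformally_symplectic P (exp (- (Gamma T - Gamma 0))).
Proof.
intros HT Hg Hc Hb Hpsi HGamma.
assert (Hrevc : forall f : R -> R, (forall t, continuous f t) ->
                forall t, continuous (fun s => f (T - s)) t).
{ intros f Hf t. apply (continuous_comp (fun s => T - s) f); auto.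
  apply (continuous_minus (fun _ => T) (fun s => s)).
  - apply continuous_const.
  - apply continuous_id. }
set (g' := fun t => - g (T - t)). set (c' := fun t => - c (T - t)).
set (b' := fun t => - b (T - t)). set (psi' := fun t => psi (T - t)).
assert (Hg' : forall t, continuous g' t) by (intro; apply continuous_Ropp; auto).
assert (Hc' : forall t, continuous c' t) by (intro; apply continuous_Ropp; auto).
assert (Hb' : forall t, continuous b' t) by (intro; apply continuous_Ropp; auto).
assert (Hpsi' : forall t, continuous psi' t) by (intro; unfold psi'; auto).
set (P := pendulum_map 1 g c b psi T). set (Q := pendulum_map (- 1) g' c' b' psi' T).
assert (HP : time_map (planar_solution (velocity 1) (pendulum_force g c b psi)) 0 T P)
  by now apply pendulum_time_map.
assert (HQ : time_map (planar_solution (velocity (- 1)) (pendulum_force g' c' b' psi')) 0 T Q)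
  by now apply pendulum_time_map.
assert (Hsame : forall p q, p = q -> same_state p q).
{ intros p q ->. split; auto. exists 0%Z. ring. }
exists P. split; auto. split; [split|].
- now apply pendulum_smooth.
- exists Q. split; [now apply pendulum_smooth|]. split; intros p; apply Hsame.
  + apply (time_map_inverse _ _ T P Q) with (2 := HP) (3 := HQ).
    intros x y. now apply pendulum_reverse.
  + apply (time_map_inverse _ _ T Q P) with (2 := HQ) (3 := HP).
    intros x y. apply pendulum_reverse; [ring|..]; intros t;
      unfold g', c', b', psi'; replace (T - (T - t)) with t by ring; ring.
- now apply pendulum_pullback.
Qed.

(** * Keplerian motion *)

Section Kepler.

Variables (a e : R) (u r f : R -> R).
Hypotheses (ha : 0 < a) (he : 0 <= e < 1) (horbit : keplerian a e u r f).

(** The ratio of the semiaxes of the ellipse. *)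
Let s := sqrt (1 - e ^ 2).

Lemma eccentricity_sqrt : 0 < s /\ s ^ 2 = 1 - e ^ 2.
Proof.
assert (H : 0 < 1 - e ^ 2) by nra. split.
- now apply sqrt_lt_R0.
- unfold s. apply pow2_sqrt. lra.
Qed.

Lemma radius_factor_pos x : 0 < 1 - e * cos x.
Proof. assert (A := COS_bound x). nra. Qed.

(** The function [x - e sin x] expands distances by a factor at least [1 - e], so
    that the eccentric anomaly is unique and Lipschitz in time. *)
Lemma kepler_expansive x y : (1 - e) * Rabs (y - x)
  <= Rabs ((y - e * sin y) - (x - e * sin x)).
Proof.
assert (A := sin_lipschitz x y).
replace (y - e * sin y - (x - e * sin x)) with ((y - x) - e * (sin y - sin x)) by ring.
assert (B := Rabs_triang_inv (y - x) (e * (sin y - sin x))).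
rewrite Rabs_mult, (Rabs_pos_eq e) in B by lra.
assert (C : e * Rabs (sin y - sin x) <= e * Rabs (y - x))
  by (apply Rmult_le_compat_l; lra).
lra.
Qed.

Lemma anomaly_unique t x : t = x - e * sin x -> u t = x.
Proof.
intros Hx. assert (A := kepler_expansive x (u t)).
rewrite <- (kepler_equation _ _ _ _ _ horbit t), <- Hx, Rminus_diag, Rabs_R0 in A.
apply Rminus_diag_uniq, eq_0_of_abs_le. intros eps He.
assert (B := Rabs_pos (u t - x)).
assert (Rabs (u t - x) <= 0); [|lra].
apply Rmult_le_reg_l with (1 - e); lra.
Qed.

Lemma anomaly_lipschitz t t' : (1 - e) * Rabs (u t' - u t) <= Rabs (t' - t).
Proof.
eapply Rle_trans; [apply kepler_expansive|].
rewrite <- !(kepler_equation _ _ _ _ _ horbit). apply Rle_refl.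
Qed.

Lemma anomaly_derive t : is_derive u t (/ (1 - e * cos (u t))).
Proof.
assert (Hr := radius_factor_pos (u t)). set (q := 1 - e * cos (u t)) in *.
split; [apply is_linear_scal_l|].
intros x Hx.
rewrite <- (is_filter_lim_locally_unique (K := R_AbsRing) (V := R_NormedModule) t x Hx).
clear x Hx. intros eps.
assert (Heps := cond_pos eps).
(* by the Taylor bound, the error is at most [|u t' - u t|^2 / q] *)
assert (Hd : 0 < eps * (q * (1 - e) ^ 2)).
{ apply Rmult_lt_0_compat; auto. apply Rmult_lt_0_compat; auto. apply pow_lt. lra. }
exists (mkposreal _ Hd). intros t' Ht'.
change (Rabs (t' - t) < eps * (q * (1 - e) ^ 2)) in Ht'.
change (Rabs (u t' - u t - (t' - t) * / q) <= eps * Rabs (t' - t)).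
assert (E : t' - t = (u t' - e * sin (u t')) - (u t - e * sin (u t)))
  by (rewrite <- !(kepler_equation _ _ _ _ _ horbit); reflexivity).
set (D := u t' - u t).
assert (E2 : D - (t' - t) * / q
             = e * (sin (u t') - sin (u t) - cos (u t) * D) * / q).
{ rewrite E. unfold D, q. field. unfold q in Hr. lra. }
rewrite E2, !Rabs_mult, (Rabs_pos_eq e) by lra.
rewrite (Rabs_pos_eq (/ q)) by (apply Rlt_le, Rinv_0_lt_compat; auto).
assert (A := sin_first_order (u t) (u t')). fold D in A.
assert (B := anomaly_lipschitz t t'). fold D in B.
assert (PD := Rabs_pos D). assert (Pt := Rabs_pos (t' - t)).
assert (C : ((1 - e) * Rabs D) ^ 2 <= Rabs (t' - t) * (eps * (q * (1 - e) ^ 2))).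
{ apply Rle_trans with (Rabs (t' - t) ^ 2).
  - apply pow_incr. split; auto. apply Rmult_le_pos; lra.
  - simpl. rewrite Rmult_1_r. apply Rmult_le_compat_l; lra. }
assert (C' : Rabs D ^ 2 <= Rabs (t' - t) * (eps * q)).
{ apply Rmult_le_reg_l with ((1 - e) ^ 2); [apply pow_lt; lra|]. nra. }
apply Rmult_le_reg_r with q; auto. rewrite Rmult_assoc, Rinv_l, Rmult_1_r by lra.
assert (0 <= Rabs (sin (u t') - sin (u t) - cos (u t) * D)) by apply Rabs_pos.
nra.
Qed.

Lemma true_anomaly_cos_sin t :
  (1 - e * cos (u t)) * cos (f t) = cos (u t) - e /\
  (1 - e * cos (u t)) * sin (f t) = s * sin (u t).
Proof.
assert (A := true_anomaly _ _ _ _ _ horbit t).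
rewrite (orbital_radius _ _ _ _ _ horbit t) in A.
unfold expi, RtoC, Cmult in A. simpl in A.
injection A as A B. unfold s.
split; apply Rmult_eq_reg_l with a; try lra; simpl; nra.
Qed.

Lemma cos_true_anomaly t : cos (f t) = (cos (u t) - e) / (1 - e * cos (u t)).
Proof.
assert (H := radius_factor_pos (u t)). destruct (true_anomaly_cos_sin t) as [A _].
rewrite <- A. field. lra.
Qed.

Lemma sin_true_anomaly t : sin (f t) = s * sin (u t) / (1 - e * cos (u t)).
Proof.
assert (H := radius_factor_pos (u t)). destruct (true_anomaly_cos_sin t) as [_ A].
rewrite <- A. field. lra.
Qed.

Lemma radius_factor_true_anomaly t :
  (1 - e * cos (u t)) * (1 + e * cos (f t)) = s ^ 2.
Proof.
rewrite (proj2 eccentricity_sqrt), cos_true_anomaly. field.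
assert (H := radius_factor_pos (u t)). lra.
Qed.

(** Near [t], the true anomaly is [f t + asin (sin (f - f t))], by continuity. *)
Lemma true_anomaly_derive t : is_derive f t (s / (1 - e * cos (u t)) ^ 2).
Proof.
assert (Hr := radius_factor_pos (u t)).
set (S := fun x => s * sin (u x) / (1 - e * cos (u x)) * cos (f t)
                   - (cos (u x) - e) / (1 - e * cos (u x)) * sin (f t)).
assert (HS : forall x, S x = sin (f x - f t)).
{ intros x. unfold S. now rewrite <- cos_true_anomaly, <- sin_true_anomaly, sin_minus. }
assert (Hdu := anomaly_derive t).
apply (is_derive_ext_loc (fun x => f t + asin (S x))).
{ assert (Hpi : 0 < PI / 2) by (assert (A := PI_RGT_0); lra).
  generalize (continuous_locally_lt f t _ (true_anomaly_continuous _ _ _ _ _ horbit t) Hpi).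
  apply filter_imp. intros x Hx. rewrite HS.
  apply Rabs_lt_between in Hx. rewrite asin_sin by lra. apply Rplus_minus. }
assert (HSd : is_derive S t (s / (1 - e * cos (u t)) ^ 2)).
{ unfold S. auto_derive.
  - repeat split; try lra; eexists; apply Hdu.
  - replace (Derive (fun x => u x) t) with (/ (1 - e * cos (u t)))
      by (symmetry; apply is_derive_unique, Hdu).
    rewrite cos_true_anomaly, sin_true_anomaly.
    assert (H1 : sin (u t) ^ 2 = 1 - cos (u t) ^ 2)
      by (assert (A := sin2_cos2 (u t)); unfold Rsqr in A; lra).
    assert (H2 := proj2 eccentricity_sqrt).
    field [H1 H2]. lra. }
evar_last.
- apply (is_derive_plus (fun _ => f t) (fun x => asin (S x))).
  + apply (is_derive_const (f t)).
  + apply (is_derive_comp asin S); [|apply HSd].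
    rewrite HS, Rminus_diag, sin_0.
    assert (H01 : -1 < 0 < 1) by lra.
    apply is_derive_Reals, (derive_pt_eq_1 asin 0 _ (derivable_pt_asin 0 H01)).
    apply derive_pt_asin.
- rewrite Rsqr_0, Rminus_0_r, sqrt_1.
  change (0 + s / (1 - e * cos (u t)) ^ 2 * (1 / 1) = s / (1 - e * cos (u t)) ^ 2).
  field. lra.
Qed.

(** [f - u] never reaches [PI] or [- PI]: the two directions would be opposite,
    which forces [sin u = 0], whereas they coincide when [u] is a multiple of
    [PI]. *)
Lemma anomaly_difference_cos t : cos (f t - u t) <> - 1.
Proof.
intros H. assert (Hr := radius_factor_pos (u t)).
assert (H0 : sin (f t - u t) = 0).
{ assert (A := sin2_cos2 (f t - u t)). unfold Rsqr in A. rewrite H in A. nra. }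
assert (Hs : sin (f t) = - sin (u t)).
{ replace (f t) with ((f t - u t) + u t) at 1 by ring.
  rewrite sin_plus, H, H0. ring. }
assert (Hc : cos (f t) = - cos (u t)).
{ replace (f t) with ((f t - u t) + u t) at 1 by ring.
  rewrite cos_plus, H, H0. ring. }
destruct (true_anomaly_cos_sin t) as [A B]. rewrite Hs in B. rewrite Hc in A.
assert (Hp := proj1 eccentricity_sqrt).
assert (Hu : sin (u t) = 0).
{ assert (C : sin (u t) * (s + (1 - e * cos (u t))) = 0) by lra.
  apply Rmult_integral in C. destruct C; lra. }
assert (D := sin2_cos2 (u t)). unfold Rsqr in D. rewrite Hu in D.
assert (E : (cos (u t) - 1) * (cos (u t) + 1) = 0) by lra.
apply Rmult_integral in E. destruct E as [E|E].
- replace (cos (u t)) with 1 in A by lra. lra.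
- replace (cos (u t)) with (- 1) in A by lra. lra.
Qed.

Lemma anomaly_0 : u 0 = 0.
Proof. apply anomaly_unique. rewrite sin_0. ring. Qed.

Lemma anomaly_2PI : u (2 * PI) = 2 * PI.
Proof. apply anomaly_unique. rewrite sin_2PI. ring. Qed.

(** The difference of the anomalies stays in [(- PI, PI)] by continuity, and it is
    a multiple of [2 PI] at the end of the revolution. *)
Lemma true_anomaly_2PI : f (2 * PI) = 2 * PI.
Proof.
set (d := fun t => f t - u t).
assert (Hd : continuity d).
{ intros t. apply continuity_pt_filterlim. unfold d.
  apply (continuous_minus f u).
  - apply (true_anomaly_continuous _ _ _ _ _ horbit).
  - eapply is_derive_continuous, anomaly_derive. }
assert (Hd0 : d 0 = 0).
{ unfold d. rewrite anomaly_0, (true_anomaly_0 _ _ _ _ _ horbit). ring. }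
assert (Hpi := PI_RGT_0).
assert (Hbelow : d (2 * PI) < PI).
{ apply Rnot_le_lt. intros H.
  destruct (IVT_gen d 0 (2 * PI) PI Hd) as [t [_ Ht]].
  - rewrite Hd0, Rmin_left, Rmax_right by lra. lra.
  - apply (anomaly_difference_cos t). fold (d t). rewrite Ht. apply cos_PI. }
assert (Habove : - PI < d (2 * PI)).
{ apply Rnot_le_lt. intros H.
  destruct (IVT_gen d 0 (2 * PI) (- PI) Hd) as [t [_ Ht]].
  - rewrite Hd0, Rmin_right, Rmax_left by lra. lra.
  - apply (anomaly_difference_cos t). fold (d t). rewrite Ht, cos_neg. apply cos_PI. }
unfold d in Hbelow, Habove. rewrite anomaly_2PI in Hbelow, Habove.
assert (Hcos : cos (f (2 * PI) - 2 * PI) = 1).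
{ rewrite cos_minus, cos_2PI, sin_2PI, cos_true_anomaly, anomaly_2PI, cos_2PI.
  field. lra. }
destruct (Req_dec (f (2 * PI) - 2 * PI) 0) as [E|E]; [lra|exfalso].
assert (Hlt : cos (f (2 * PI) - 2 * PI) < 1); [|lra].
rewrite <- cos_0.
destruct (Rlt_le_dec (f (2 * PI) - 2 * PI) 0) as [L|L].
- rewrite <- cos_neg. apply cos_decreasing_1; lra.
- apply cos_decreasing_1; lra.
Qed.

(** * The averaged dissipation *)

(** A primitive of [(1 + e cos theta)^4]. *)
Definition dissipation_primitive (theta : R) : R :=
  theta + 4 * e * sin theta + 3 * e ^ 2 * (theta + sin theta * cos theta)
  + 4 * e ^ 3 * (sin theta - sin theta ^ 3 / 3)
  + e ^ 4 * (3 * theta / 8 + 3 * (sin theta * cos theta) / 8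
             + sin theta * cos theta ^ 3 / 4).

Lemma dissipation_primitive_derive theta :
  is_derive dissipation_primitive theta ((1 + e * cos theta) ^ 4).
Proof.
unfold dissipation_primitive. auto_derive; [trivial|].
assert (H : sin theta ^ 2 = 1 - cos theta ^ 2)
  by (assert (A := sin2_cos2 theta); unfold Rsqr in A; lra).
field [H].
Qed.

Lemma dissipation_derive (eta t : R) :
  is_derive (fun t => eta / s ^ 9 * dissipation_primitive (f t)) t
    (eta * (a / r t) ^ 6).
Proof.
assert (Hr := radius_factor_pos (u t)).
assert (Hs := proj1 eccentricity_sqrt).
evar_last.
- apply (is_derive_scal (fun t => dissipation_primitive (f t))).
  apply (is_derive_comp dissipation_primitive f).
  + apply dissipation_primitive_derive.
  + apply true_anomaly_derive.
- change (eta / s ^ 9 * (s / (1 - e * cos (u t)) ^ 2 * (1 + e * cos (f t)) ^ 4)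
          = eta * (a / r t) ^ 6).
  rewrite (orbital_radius _ _ _ _ _ horbit t).
  assert (E : 1 + e * cos (f t) = s ^ 2 / (1 - e * cos (u t))).
  { rewrite <- (radius_factor_true_anomaly t). field. lra. }
  rewrite E. field. repeat split; lra.
Qed.

Lemma dissipation_integral (eta : R) :
  eta / s ^ 9 * dissipation_primitive (f (2 * PI))
  - eta / s ^ 9 * dissipation_primitive (f 0)
  = eta * PI * ((3 * e ^ 4 + 24 * e ^ 2 + 8) / (4 * Rpower (1 - e ^ 2) (9 / 2))).
Proof.
assert (Hs := proj1 eccentricity_sqrt).
assert (E : Rpower (1 - e ^ 2) (9 / 2) = s ^ 9).
{ assert (He : 0 < 1 - e ^ 2) by nra.
  unfold s. rewrite <- Rpower_sqrt by auto.
  rewrite <- (Rpower_pow 9 (Rpower (1 - e ^ 2) (/ 2))) by apply exp_pos.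
  rewrite Rpower_mult. f_equal. simpl. field. }
rewrite E, true_anomaly_2PI, (true_anomaly_0 _ _ _ _ _ horbit).
unfold dissipation_primitive. rewrite sin_2PI, cos_2PI, sin_0, cos_0. field. lra.
Qed.

Lemma true_anomaly_derivative_continuous t : continuous (Derive f) t.
Proof.
apply (continuous_ext (fun x => s / (1 - e * cos (u x)) ^ 2)).
{ intros x. symmetry. apply is_derive_unique, true_anomaly_derive. }
assert (Hr := radius_factor_pos (u t)).
apply (ex_derive_continuous (fun x => s / (1 - e * cos (u x)) ^ 2)). auto_derive.
split; [eexists; apply anomaly_derive|]. split; auto.
apply Rgt_not_eq. apply Rmult_lt_0_compat; lra.
Qed.

Lemma radius_ratio_continuous n (k t : R) : continuous (fun x => k * (a / r x) ^ n) t.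
Proof.
apply (continuous_ext (fun x => k * (a / (a * (1 - e * cos (u x)))) ^ n)).
{ intros x. now rewrite (orbital_radius _ _ _ _ _ horbit x). }
assert (Hr := radius_factor_pos (u t)).
apply (ex_derive_continuous (fun x => k * (a / (a * (1 - e * cos (u x)))) ^ n)). auto_derive.
split; [eexists; apply anomaly_derive|]. split; auto.
apply Rgt_not_eq. apply Rmult_lt_0_compat; lra.
Qed.

End Kepler.

(** * The spin-orbit problem *)

Lemma spin_orbit_pendulum (a eps eta : R) (r f x y : R -> R) :
  spin_orbit_solution a eps eta r f x y <->
  planar_solution (velocity 1)
    (pendulum_force (fun t => eta * (a / r t) ^ 6)
       (fun t => eta * (a / r t) ^ 6 * Derive f t)
       (fun t => eps * (a / r t) ^ 3) (fun t => 2 * f t)) x y.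
Proof.
unfold planar_solution, velocity, pendulum_force.
split; intros H t; specialize (H t).
- destruct H as [Hx [Hy E]]. split; [now rewrite Rmult_1_l|].
  evar_last; [apply Derive_correct, Hy|]. lra.
- destruct H as [Hx Hy]. rewrite Rmult_1_l in Hx. split; auto.
  split; [eexists; apply Hy|].
  rewrite (is_derive_unique _ _ _ Hy). ring.
Qed.

Lemma time_map_ext (solution solution' : (R -> R) -> (R -> R) -> Prop) t0 t1 g :
  (forall x y, solution x y <-> solution' x y) ->
  time_map solution t0 t1 g -> time_map solution' t0 t1 g.
Proof.
intros H Hg p. destruct (Hg p) as [[x [y [Hs Hp]]] Hu]. split.
- exists x, y. split; auto. now apply H.
- intros x' y' Hs'. apply Hu. now apply H.
Qed.

Theorem corollary4p4 (a e eps eta : R) (u r f : R -> R)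
  (ha : 0 < a) (he : 0 <= e < 1) (heps : 0 < eps) (heta : 0 < eta)
  (horbit : keplerian a e u r f) :
  exists g : R * R -> R * R,
    time_map (spin_orbit_solution a eps eta r f) 0 (2 * PI) g /\
    conformally_symplectic g
      (exp (- eta * PI * ((3 * e ^ 4 + 24 * e ^ 2 + 8)
                          / (4 * Rpower (1 - e ^ 2) (9 / 2))))).
Proof.
destruct (pendulum_conformally_symplectic (2 * PI)
  (fun t => eta * (a / r t) ^ 6) (fun t => eta * (a / r t) ^ 6 * Derive f t)
  (fun t => eps * (a / r t) ^ 3) (fun t => 2 * f t)
  (fun t => eta / sqrt (1 - e ^ 2) ^ 9 * dissipation_primitive e (f t)))
  as [g [Hg Hsymp]].
- assert (H := PI_RGT_0). lra.
- intros t. now apply (radius_ratio_continuous a e u r f).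
- intros t. apply (continuous_Rmult (fun t => eta * (a / r t) ^ 6)).
  + now apply (radius_ratio_continuous a e u r f).
  + now apply (true_anomaly_derivative_continuous a e u r f).
- intros t. now apply (radius_ratio_continuous a e u r f).
- intros t. apply (continuous_Rmult (fun _ => 2)); [apply continuous_const|].
  apply (true_anomaly_continuous _ _ _ _ _ horbit).
- intros t. now apply (dissipation_derive a e u r f).
- exists g. split.
  + apply (time_map_ext _ _ _ _ _ (fun x y => iff_sym (spin_orbit_pendulum a eps eta r f x y))).
    exact Hg.
  + rewrite (dissipation_integral a e u r f ha he horbit eta) in Hsymp.
    replace (- eta * PI * ((3 * e ^ 4 + 24 * e ^ 2 + 8)
                          / (4 * Rpower (1 - e ^ 2) (9 / 2))))
      with (- (eta * PI * ((3 * e ^ 4 + 24 * e ^ 2 + 8)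
                          / (4 * Rpower (1 - e ^ 2) (9 / 2))))) by ring.
    exact Hsymp.
Qed.
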